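(* Let $m\ge2$ and $0\le q\le m-1$ be integers, let $\mu:=(2^{(q)},1^{(2m-2q)},0^{(q)})$, and let $w\in\widetilde W_{D_m}$. For $0\le k\le m$ put $\nu_k^w:=wa_k-a_k$, and consider the conditions: (SP1$'$) $\nu_k^w+(\nu_k^w)^*=\mathbf2$ and $\mathbf0\le\nu_k^w\le\mathbf2$; (SP2$'$) $\#\{j:\nu_k^w(j)=2\}+\frac14\#\{j:\nu_k^w(j)\notin\mathbb Z\}\le q$; (SP3$'$) if $\nu_k^w\in\mathbb Z^{2m}$ and $\nu_k^w\not\equiv\mu\bmod Q^\vee_{D_m}$, then there exist $j_1\in A_k$ and $j_2\in B_k$ with $\nu_k^w(j_1)=\nu_k^w(j_2)=1$. Then $w$ is $\mu$-permissible if and only if (SP1$'$) and (SP2$'$) hold for all $0\le k\le m$ and (SP3$'$) holds for $k=0,1,m-1,m$.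
   Context: Notation. For $v\in\mathbb R^{n}$, $v(j)$ is the $j$th entry, $v^*(j)=v(n+1-j)$, $\mathbf d=(d,\dots,d)$, $v\ge w$ means entrywise, and $(d^{(i)},e^{(j)},\dots)$ denotes $d$ repeated $i$ times, then $e$ repeated $j$ times, etc. $i^*:=2m+1-i$ for $i\in\{1,\dots,2m\}$. Root datum of split $GO_{2m}$. $X_*:=\{x\in\mathbb Z^{2m}: x_1+x_{2m}=\dots=x_m+x_{m+1}\}$; $Q^\vee_{D_m}:=\{x\in X_*: x_i+x_{i^*}=0\ \forall i,\ x_1+\dots+x_m\text{ even}\}$; $S_{2m}^\circ$ is the group of even permutations $\sigma\in S_{2m}$ with $\sigma(i^* )=\sigma(i)^*$ for all $i$. $\widetilde W_{D_m}:=X_*\rtimes S_{2m}^\circ$ acts on $\mathcal A:=X_*\otimes\mathbb R\subset\mathbb R^{2m}$ by affine transformations, $X_*$ by translations ($t_\lambda$) and $S_{2m}^\circ$ by permuting coordinates; $W_{\mathrm{aff},D_m}:=Q^\vee_{D_m}\rtimes S_{2m}^\circ$. The base alcove is $A_{D_m}:=\{x\in\mathcal A: x_1,\,x_{2m}-1<x_2<\dots<x_{m-1}<x_m,\,x_{m+1}\}$ (for $m=2$: $x_1,x_4-1<x_2,x_3$). $a_k:=((-\frac12)^{(k)},0^{(2m-2k)},(\frac12)^{(k)})$ for $0\le k\le m$; $A_k:=\{1,\dots,k\}\cup\{2m+1-k,\dots,2m\}$; $B_k:=\{k+1,\dots,2m-k\}$. $w\in\widetilde W_{D_m}$ is $\mu$-permissible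 if $w\equiv t_\mu\bmod W_{\mathrm{aff},D_m}$ and $wv-v\in\mathrm{Conv}(S_{2m}^\circ\mu)$ for all $v\in A_{D_m}$, where $\mathrm{Conv}(S_{2m}^\circ\mu)$ is the convex hull in $\mathcal A$ of the Weyl orbit of $\mu$. *)

(* Defs.v *)
(* MathComp / MathComp-Analysis; the real numbers are an arbitrary R : realType. *)
From HB Require Import structures.
From mathcomp Require Import all_boot all_order all_algebra all_fingroup.
From mathcomp Require Import boolp classical_sets reals convex.

Set Implicit Arguments.
Unset Strict Implicit.
Unset Printing Implicit Defensive.

Import Order.TTheory GRing.Theory Num.Theory.

Local Open Scope classical_set_scope.
Local Open Scope ring_scope.

(* Coordinates are indexed from 0: the 1-based index j is the ordinal j - 1 of
   'I_(m.*2), so that the involution j |-> 2m + 1 - j is [rev_ord]. *)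

Definition cochar (m : nat) : set 'rV[int]_(m.*2) :=
  [set x | forall i j, x 0 i + x 0 (rev_ord i) = x 0 j + x 0 (rev_ord j)].
Arguments cochar : clear implicits.

Definition corootD (m : nat) : set 'rV[int]_(m.*2) :=
  [set x | [/\ cochar m x, forall i, x 0 i + x 0 (rev_ord i) = 0 &
             (2 %| (\sum_(i < m.*2 | (i < m)%N) x 0 i)%R)%Z]].
Arguments corootD : clear implicits.

Definition weylD (m : nat) : {set 'S_(m.*2)} :=
  [set s : 'S_(m.*2) |
     ~~ odd_perm s & [forall i, s (rev_ord i) == rev_ord (s i)]]%SET.

(* The left action of the symmetric group on coordinates, sending the i-th
   basis vector to the (s i)-th one. *)
Definition perm_act (V : Type) (n : nat) (s : 'S_n) (v : 'rV[V]_n) : 'rV[V]_n :=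
  col_perm s^-1%g v.

(* The pair (l, s) stands for the affine map v |-> l + s v, an element of
   Z^n semidirect S_n. *)
Definition affperm (n : nat) : Type := ('rV[int]_n * 'S_n)%type.

Definition affact (R : pzRingType) (n : nat) (w : affperm n) (v : 'rV[R]_n) :
  'rV[R]_n := map_mx intr w.1 + perm_act w.2 v.

(* In MathComp (s * t)%g is "s first, then t"; the order of the permutations is
   thus reversed, so that [affmul w w'] acts as w after w' (see [affactM]). *)
Definition affmul (n : nat) (w w' : affperm n) : affperm n :=
  (w.1 + perm_act w.2 w'.1, (w'.2 * w.2)%g).

Definition transl (n : nat) (l : 'rV[int]_n) : affperm n := (l, 1%g).

Lemma affactM (R : pzRingType) (n : nat) (w w' : affperm n) (v : 'rV[R]_n) :
  affact (affmul w w') v = affact w (affact w' v).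
Proof.
apply/rowP => j; rewrite /affact /affmul /perm_act !mxE /= rmorphD /= -addrA.
by rewrite invMg permM.
Qed.

Definition extWeylD (m : nat) : set (affperm m.*2) :=
  [set w | cochar m w.1 /\ w.2 \in weylD m].
Arguments extWeylD : clear implicits.

Definition affWeylD (m : nat) : set (affperm m.*2) :=
  [set w | corootD m w.1 /\ w.2 \in weylD m].
Arguments affWeylD : clear implicits.

Definition eqmod_affWeylD (m : nat) (w w' : affperm m.*2) : Prop :=
  exists2 u, affWeylD m u & w = affmul u w'.

(* The real span of X_* in R^2m, i.e. the image of X_* (x) R. *)
Definition apartment (R : realType) (m : nat) : set 'rV[R]_(m.*2) :=
  [set v | exists (n : nat) (c : 'I_n -> R) (x : 'I_n -> 'rV[int]_(m.*2)),
     (forall i, cochar m (x i)) /\ v = \sum_(i < n) c i *: map_mx intr (x i)].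
Arguments apartment : clear implicits.

Lemma apartmentP (R : realType) (m : nat) (v : 'rV[R]_(m.*2)) :
  apartment R m v <->
  forall i j, v 0 i + v 0 (rev_ord i) = v 0 j + v 0 (rev_ord j).
Proof.
split.
  move=> [n [c [x [xX ->]]]] i j; rewrite !summxE -!big_split /=.
  apply: eq_bigr => k _; rewrite !mxE -!mulrDr -!rmorphD /=.
  by congr (_ * _%:~R); exact: xX.
case: m v => [|m] v hv.
  exists 0%N, (fun=> 0), (fun=> 0); split=> [[]//|].
  by apply/rowP; case.
pose c0 := v 0 ord0 + v 0 (rev_ord ord0).
pose c (i : 'I_m.+1.*2.+1) := if unlift ord0 i is Some j then v 0 j / 2 else c0 / 2.
pose x (i : 'I_m.+1.*2.+1) : 'rV[int]_m.+1.*2 :=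
  if unlift ord0 i is Some j then delta_mx 0 j - delta_mx 0 (rev_ord j)
  else const_mx 1.
exists _, c, x; split.
  move=> i; rewrite /x; case: (unlift _ _) => [j|] k l; rewrite !mxE ?eqxx //=.
  by rewrite !(can2_eq (@rev_ordK _) (@rev_ordK _)) !rev_ordK !addrA !subrK !subrr.
apply/rowP => k; rewrite summxE big_ord_recl /c /x unlift_none !mxE mulr1.
under eq_bigr => i _ do rewrite liftK !mxE eqxx /= rmorphB mulrBr.
rewrite sumrB (bigD1 k) //= eqxx mulr1 big1 ?addr0; last first.
  by move=> i /negPf; rewrite eq_sym => ->; rewrite mulr0.
rewrite (bigD1 (rev_ord k)) //= rev_ordK eqxx mulr1 big1 ?addr0; last first.
  move=> i; rewrite -(inj_eq rev_ord_inj) rev_ordK eq_sym => /negPf ->.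
  by rewrite mulr0.
by rewrite /c0 (hv _ k) -mulrBl -mulrDl addrACA subrr addr0 mulrDl -splitr.
Qed.

(* The j-th entry, 1 <= j <= n, with the 1-based numbering. *)
Definition entry (R : nmodType) (n : nat) (v : 'rV[R]_n) (j : nat) : R :=
  oapp (fun i : 'I_n => v 0 i) 0 (insub j.-1).
Arguments entry {R n} v j%_N.

Definition base_alcoveD (R : realType) (m : nat) : set 'rV[R]_(m.*2) :=
  [set v | apartment R m v /\
     if (m == 2)%N then
       [/\ entry v 1 < entry v 2, entry v 1 < entry v 3,
           entry v 4 - 1 < entry v 2 & entry v 4 - 1 < entry v 3]
     else
       [/\ entry v 1 < entry v 2, entry v m.*2 - 1 < entry v 2,
           forall j, (2 <= j)%N -> (j.+1 <= m.-1)%N ->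
             entry v j < entry v j.+1,
           entry v m.-1 < entry v m & entry v m.-1 < entry v m.+1]].
Arguments base_alcoveD : clear implicits.

(* The hull is taken in R^2m; it lies in the subspace [apartment R m] as soon
   as mu is in X_*. *)
Definition conv_weyl_orbit (R : realType) (m : nat) (mu : 'rV[int]_(m.*2)) :
  set 'rV[R]_(m.*2) :=
  smallest (@convex_set R 'rV[R]_(m.*2))
    [set v | exists2 s, s \in weylD m & v = perm_act s (map_mx intr mu)].
Arguments conv_weyl_orbit : clear implicits.

Definition permissibleD (R : realType) (m : nat) (mu : 'rV[int]_(m.*2))
    (w : affperm m.*2) : Prop :=
  eqmod_affWeylD w (transl mu) /\
  forall v, base_alcoveD R m v -> conv_weyl_orbit R m mu (affact w v - v).

Definition muq (m q : nat) : 'rV[int]_(m.*2) :=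
  \row_(j < m.*2)
    if (j < q)%N then 2 else if (j < m.*2 - q)%N then 1 else 0.

Definition face_point (R : realType) (m k : nat) : 'rV[R]_(m.*2) :=
  \row_(j < m.*2)
    if (j < k)%N then - 2^-1 else if (j < m.*2 - k)%N then 0 else 2^-1.

Definition outer_idx (m k : nat) : {set 'I_(m.*2)} :=
  [set j : 'I_(m.*2) | (j < k)%N || (m.*2 - k <= j)%N]%SET.

Definition inner_idx (m k : nat) : {set 'I_(m.*2)} :=
  [set j : 'I_(m.*2) | (k <= j < m.*2 - k)%N]%SET.

Definition nuvec (R : realType) (m : nat) (w : affperm m.*2) (k : nat) :
  'rV[R]_(m.*2) := affact w (face_point R m k) - face_point R m k.

Definition starv (R : Type) (n : nat) (v : 'rV[R]_n) : 'rV[R]_n :=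
  \row_j v 0 (rev_ord j).

Definition SP1 (R : realType) (m : nat) (nu : 'rV[R]_(m.*2)) : Prop :=
  nu + starv nu = const_mx 2 /\ forall j, 0 <= nu 0 j <= 2.

Definition SP2 (R : realType) (m q : nat) (nu : 'rV[R]_(m.*2)) : Prop :=
  #|[set j | nu 0 j == 2]%SET|%:R
    + 4^-1 * #|[set j | nu 0 j \isn't a Num.int]%SET|%:R <= q%:R :> R.

Definition eqmod_corootD (R : realType) (m : nat) (nu : 'rV[R]_(m.*2))
    (mu : 'rV[int]_(m.*2)) : Prop :=
  exists2 x, corootD m x & nu - map_mx intr mu = map_mx intr x.

Definition SP3 (R : realType) (m q k : nat) (nu : 'rV[R]_(m.*2)) : Prop :=
  (forall j, nu 0 j \is a Num.int) -> ~ eqmod_corootD nu (muq m q) ->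
  exists j1 j2, [/\ j1 \in outer_idx m k, j2 \in inner_idx m k,
                    nu 0 j1 = 1 & nu 0 j2 = 1].

(* Main.v *)
(* The convex hull of the orbit of mu = (2^q, 1^(2m-2q), 0^q) consists of the v with
   v + v^* = 2, |v(j) - 1| <= 1 and sum_j |v(j) - 1| <= 2q: a point with enough
   room, or with two fractional pairs of coordinates, is a proper convex
   combination of two simpler ones, and the remaining points form the orbit.  For
   half-integral vectors these conditions are (SP1') and (SP2').

   By convexity w is permissible iff it is congruent to t_mu and w v - v lies in
   the hull for the vertices v of the closed base alcove, which are a_0, a_0',
   a_2, ..., a_(m-2), a_m, a_m' with a_0' and a_m' the reflections of a_0 and a_m
   through a_1 and a_(m-1).  It remains to see that, given the hull conditions at
   a_0, a_1 (resp. a_m, a_(m-1)), the one at a_0' (resp. a_m') is (SP3') for k = 1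
   (resp. k = m - 1).  If nu_1 is not integral this is a parity argument; if it is
   integral and not congruent to mu, then w flips the two coordinates that
   distinguish a_0 from a_0', and (SP3') says that w a_0 - a_0 is extremal there.
   The case k = 0 of (SP3') is the congruence, and the case k = m follows from it
   because elements of the Weyl group make an even number of sign changes. *)

Require Import Defs.
From mathcomp Require Import all_boot all_order all_algebra all_fingroup.
From mathcomp Require Import boolp classical_sets reals convex.
From mathcomp Require Import interval_inference ring lra zify.

Set Implicit Arguments.
Unset Strict Implicit.
Unset Printing Implicit Defensive.

Import Order.TTheory GRing.Theory Num.Theory.

Local Open Scope classical_set_scope.
Local Open Scope ring_scope.

(** * Coordinates of row vectors *)

Lemma row_addE (R : nzRingType) (n : nat) (x y : 'rV[R]_n) j :
  (x + y) 0 j = x 0 j + y 0 j.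
Proof. by rewrite mxE. Qed.

Lemma row_oppE (R : nzRingType) (n : nat) (x : 'rV[R]_n) j :
  (- x) 0 j = - x 0 j.
Proof. by rewrite mxE. Qed.

Lemma row_scaleE (R : nzRingType) (n : nat) (a : R) (x : 'rV[R]_n) j :
  (a *: x) 0 j = a * x 0 j.
Proof. by rewrite mxE. Qed.

Definition row_linE := (row_addE, row_oppE, row_scaleE).

(** * Antisymmetric index pairs and the explicit hull *)

Lemma rev_ord_neq (m : nat) (j : 'I_(m.*2)) : rev_ord j != j.
Proof. by apply/eqP => /(congr1 val) /=; have := ltn_ord j; lia. Qed.

Lemma rev_ord_eqC (n : nat) (i j : 'I_n) : (rev_ord i == j) = (i == rev_ord j).
Proof. by rewrite (can2_eq (@rev_ordK _) (@rev_ordK _)). Qed.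

Lemma ltn_rev_ord (m : nat) (j : 'I_(m.*2)) : (rev_ord j < m)%N = ~~ (j < m)%N.
Proof. by have := ltn_ord j; rewrite /=; lia. Qed.

Lemma sum_rev_ord (V : zmodType) (m : nat) (f : 'I_(m.*2) -> V) :
  \sum_j f j = \sum_(j < m.*2 | (j < m)%N) (f j + f (rev_ord j)).
Proof.
rewrite big_split /= (bigID (fun j : 'I_(m.*2) => (j < m)%N)) /=; congr (_ + _).
rewrite (reindex_inj rev_ord_inj); apply: eq_bigl => j.
by rewrite ltn_rev_ord negbK.
Qed.

(** The weight in [convex_set] is a bundled element of $[0,1]$; here it is a plain real number with
    bounds. *)
Lemma convex_set_comb (R : realType) (M : lmodType R) (A : set M) (x y : M)
    (p : R) :
  convex_set A -> 0 <= p <= 1 -> A x -> A y -> A (p *: x + (1 - p) *: y).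
Proof.
move=> cA /andP[p0 p1] Ax Ay.
have /set_mem := cA x y (Itv01 p0 p1) (mem_set Ax) (mem_set Ay).
by [].
Qed.

Section Weyl.
Variable m : nat.
Implicit Types s t : 'S_(m.*2).

Lemma weylDP s : reflect (~~ odd_perm s /\ forall i, s (rev_ord i) = rev_ord (s i))
  (s \in weylD m).
Proof.
rewrite inE; apply: (iffP andP) => -[-> h]; split=> //.
  by move=> i; apply/eqP; exact: (forallP h).
by apply/forallP => i; apply/eqP.
Qed.

Lemma weylD_rev s i : s \in weylD m -> s (rev_ord i) = rev_ord (s i).
Proof. by case/weylDP. Qed.

Lemma weylDV s : s \in weylD m -> s^-1%g \in weylD m.
Proof.
case/weylDP => os rs; apply/weylDP; rewrite odd_permV; split=> // i.
by apply: (@perm_inj _ s); rewrite rs !permKV.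
Qed.

End Weyl.

Lemma perm_actE (V : Type) (n : nat) (s : 'S_n) (v : 'rV[V]_n) j :
  perm_act s v 0 j = v 0 (s^-1%g j).
Proof. by rewrite mxE. Qed.

Section Hull.
Variables (R : realType) (m q : nat).
Implicit Types (v : 'rV[R]_(m.*2)) (i j : 'I_(m.*2)).

Definition dual2 v := forall j, v 0 j + v 0 (rev_ord j) = 2.

(** After translation by $-\mathbf 1$ these are the antisymmetric vectors in the unit cube and in
    the $\ell^1$-ball of radius $2q$. *)
Definition hullD v := [/\ dual2 v, forall j, `|v 0 j - 1| <= 1
  & \sum_j `|v 0 j - 1| <= 2 * q%:R].

Lemma dual2_rev v j : dual2 v -> v 0 (rev_ord j) = 2 - v 0 j.
Proof. by move=> /(_ j) <-; rewrite addrC addKr. Qed.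

Lemma hullD_convex : convex_set (hullD : set 'rV[R]_(m.*2)).
Proof.
move=> x y l /set_mem[x1 x2 x3] /set_mem[y1 y2 y3]; apply/mem_set.
have p0 : 0 <= l%:num by exact: ge0.
have p1 : l%:num <= 1 by exact: le1.
have -> : conv l x y = l%:num *: (x : 'rV[R]_(m.*2)) + (1 - l%:num) *: y by [].
set p := l%:num in p0 p1 *.
have h j : `|(p *: x + (1 - p) *: y) 0 j - 1| <=
    p * `|x 0 j - 1| + (1 - p) * `|y 0 j - 1|.
  have q0 : 0 <= 1 - p by lra.
  have -> : (p *: x + (1 - p) *: y) 0 j - 1 =
      p * (x 0 j - 1) + (1 - p) * (y 0 j - 1) by rewrite !mxE; ring.
  by apply: le_trans (ler_normD _ _) _; rewrite !normrM (ger0_norm p0) (ger0_norm q0).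
split.
- by move=> j; rewrite !mxE; move: (x1 j) (y1 j); nra.
- by move=> j; apply: le_trans (h j) _; have := x2 j; have := y2 j; nra.
- apply: le_trans (ler_sum _ (fun j _ => h j)) _.
  by rewrite big_split /= -!mulr_sumr; nra.
Qed.

(** The partner coordinate moves along so that [dual2] survives. The perturbations of points below
    are compositions of this move. *)
Definition upd v i (a : R) : 'rV[R]_(m.*2) :=
  \row_j if j == i then a else if j == rev_ord i then 2 - a else v 0 j.

Lemma upd_dual2 v i a : dual2 v -> dual2 (upd v i a).
Proof.
move=> hv j; rewrite !mxE (inj_eq rev_ord_inj) rev_ord_eqC.
case: (eqVneq j i) => [->|ji].
  by rewrite eq_sym (negPf (rev_ord_neq _)); ring.
by case: eqVneq => [_|_]; [ring|exact: hv].
Qed.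

Lemma upd_out v i a j : j != i -> j != rev_ord i -> upd v i a 0 j = v 0 j.
Proof. by move=> /negPf h /negPf h'; rewrite mxE h h'. Qed.

(** Kept general in [g] because it serves both the real distance to 1 and the integer [weight]. The
    factor 2 is the contribution of the partner coordinate. *)
Lemma sum_upd (V : comRingType) (g : R -> V) v i a :
  (forall x, g (2 - x) = g x) -> dual2 v ->
  \sum_j g (upd v i a 0 j) = \sum_j g (v 0 j) + (g a - g (v 0 i)) *+ 2.
Proof.
move=> hg hv; rewrite [in RHS](bigD1 i) //= [in RHS](bigD1 (rev_ord i)) /=;
  last exact: rev_ord_neq.
rewrite (bigD1 i) //= (bigD1 (rev_ord i)) /=; last exact: rev_ord_neq.
rewrite (dual2_rev _ hv) hg !mxE eqxx (negPf (rev_ord_neq _)) eqxx hg.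
rewrite (eq_bigr (fun j => g (v 0 j))); last first.
  by move=> j /andP[h h']; rewrite upd_out.
by rewrite mulr2n; ring.
Qed.

Lemma upd_comb v i a b p : dual2 v -> v 0 i = p * a + (1 - p) * b ->
  v = p *: upd v i a + (1 - p) *: upd v i b.
Proof.
move=> hv h; apply/rowP => j; rewrite !mxE; case: eqVneq => [->//|_].
by case: eqVneq => [->|_]; rewrite ?(dual2_rev _ hv) ?h; ring.
Qed.

Lemma dist1_sym (x : R) : `|2 - x - 1| = `|x - 1|.
Proof. by rewrite distrC; congr `|_|; ring. Qed.

Lemma upd_hull v i a : dual2 v -> (forall j, `|v 0 j - 1| <= 1) ->
  `|a - 1| <= 1 -> \sum_j `|v 0 j - 1| + 2 * (`|a - 1| - `|v 0 i - 1|) <= 2 * q%:R ->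
  hullD (upd v i a).
Proof.
move=> hv h1 ha hs; split; first exact: upd_dual2.
  move=> j; rewrite mxE; case: eqVneq => // _.
  by case: eqVneq => // _; rewrite dist1_sym.
by rewrite (sum_upd i a dist1_sym hv) -[_ *+ 2]mulr_natl.
Qed.

End Hull.

(** * Points of the orbit *)

Section Mu.
Variables (m q : nat).
Hypothesis qm : (q < m)%N.
Implicit Types i j : 'I_(m.*2).

Lemma muq_rev j : muq m q 0 j + muq m q 0 (rev_ord j) = 2.
Proof.
rewrite !mxE /=; have := ltn_ord j.
by case: ifP => ?; case: ifP => ?; try case: ifP => ?; try case: ifP => ? //; lia.
Qed.

Lemma muq_half j : (j < m)%N -> muq m q 0 j = 1 + (j < q)%N%:R.
Proof.
by move=> jm; rewrite !mxE; case: ifP => // h; rewrite ifT ?addr0 //; lia.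
Qed.

Lemma sum_half_lt (V : nzRingType) :
  \sum_(j < m.*2 | (j < m)%N) (j < q)%N%:R = q%:R :> V.
Proof.
rewrite -natr_sum; congr _%:R.
have mm : (m <= m.*2)%N by lia.
rewrite -(big_ord_widen m.*2 (fun k => (k < q)%N : nat)) //.
rewrite (_ : (\sum_(i < m) (i < q) = \sum_(i < m | (i < q)%N) 1)%N); last first.
  by rewrite [RHS]big_mkcond; apply: eq_bigr => i _; case: ifP.
by rewrite -(big_ord_widen m (fun=> 1%N) (ltnW qm)) sum1_card card_ord.
Qed.

End Mu.

Section SortOrbit.
Variables (R : realType) (m q : nat).
Hypothesis qm : (q < m)%N.
Variable v : 'rV[R]_(m.*2).
Hypothesis v_dual : dual2 v.
Hypothesis v012 : forall j, v 0 j \in [:: 0; 1; 2].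
Hypothesis v2 : #|[set j | v 0 j == 2]%SET| = q.

Let P := [set j | v 0 j == 2]%SET.
(** One index from each pair $\{j,j^*\}$: the one with the larger value and, when both values are 1,
    the one in the first half. *)
Let H := [set j | (v 0 j == 2) || (v 0 j == 1) && (j < m)%N]%SET.
Let L := enum P ++ enum (H :\: P)%SET.

Let revH j : (rev_ord j \in H) = (j \notin H).
Proof.
rewrite !inE (dual2_rev _ v_dual) ltn_rev_ord.
have := v012 j; rewrite !inE => /or3P[]/eqP->.
- by rewrite subr0 eqxx !(eq_sym 0) pnatr_eq0 oner_eq0.
- rewrite (_ : 2 - 1 = 1) ?eqxx; last by ring.
  by rewrite (eqr_nat R 1 2) /=; case: (_ < _)%N.
- by rewrite subrr eqxx !(eq_sym 0) pnatr_eq0 oner_eq0.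
Qed.

Let cardH : #|H| = m.
Proof.
have : (#|H| + #|~: H|%SET = m.*2)%N by rewrite cardsC card_ord.
have -> : (~: H = @rev_ord _ @: H)%SET.
  apply/setP => j; rewrite inE -revH; apply/idP/imsetP => [h|[i iH ->]].
    by exists (rev_ord j); rewrite ?rev_ordK.
  by rewrite rev_ordK.
by rewrite card_imset; [lia|exact: rev_ord_inj].
Qed.

Let PH : (P \subset H)%SET.
Proof. by apply/fintype.subsetP => j; rewrite !inE => ->. Qed.

Let sizeL : size L = m.
Proof.
by rewrite size_cat -!cardE cardsD (finset.setIidPr PH) cardH v2 addnC subnK // ltnW.
Qed.

Let memL j : (j \in L) = (j \in H).
Proof.
rewrite mem_cat !mem_enum finset.in_setD; case: (boolP (j \in P)) => //= h.
by rewrite (fintype.subsetP PH _ h).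
Qed.

Let uniqL : uniq L.
Proof.
rewrite cat_uniq !enum_uniq /= andbT; apply/hasPn => j.
by rewrite !mem_enum inE => /andP[].
Qed.

Let nthL (i : 'I_(m.*2)) k : (k < m)%N -> nth i L k \in H.
Proof. by move=> km; rewrite -memL mem_nth // sizeL. Qed.

(** The first half goes onto [H] in the order of [L], which lists the positions of value 2 first, as
    $\mu$ does; the second half follows by symmetry. *)
Let sg (i : 'I_(m.*2)) : 'I_(m.*2) :=
  if (i < m)%N then nth i L i else rev_ord (nth i L (rev_ord i)).

Let sgH i : (sg i \in H) = (i < m)%N.
Proof.
rewrite /sg; case: ifP => im; first by rewrite nthL.
by rewrite revH nthL // ltn_rev_ord im.
Qed.

Let sg_inj : injective sg.
Proof.
move=> i j e; have := sgH i; rewrite e sgH => jm; move: e; rewrite /sg jm.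
case: ifP => im.
  rewrite (set_nth_default j) ?sizeL // => /eqP.
  by rewrite nth_uniq ?sizeL ?jm // => /eqP/val_inj.
have im' : (rev_ord i < m)%N by rewrite ltn_rev_ord im.
have jm' : (rev_ord j < m)%N by rewrite ltn_rev_ord jm im.
move=> /rev_ord_inj; rewrite (set_nth_default j) ?sizeL // => /eqP.
by rewrite nth_uniq ?sizeL // => /eqP/val_inj/rev_ord_inj.
Qed.

Let sg_rev i : sg (rev_ord i) = rev_ord (sg i).
Proof.
have d k : (k < m)%N -> nth (rev_ord i) L k = nth i L k.
  by move=> km; apply: set_nth_default; rewrite sizeL.
rewrite /sg ltn_rev_ord rev_ordK; case: (boolP (i < m)%N) => im.
  by rewrite /= d.
by rewrite d ?rev_ordK // ltn_rev_ord.
Qed.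

Let sgE_half (i : 'I_(m.*2)) : (i < m)%N -> v 0 (sg i) = (muq m q 0 i)%:~R.
Proof.
move=> im; rewrite muq_half // /sg im nth_cat -cardE v2.
case: ifP => iq.
  have : nth i (enum P) i \in P by rewrite -mem_enum mem_nth // -cardE v2.
  by rewrite inE => /eqP ->.
have : nth i (enum (H :\: P)%SET) (i - q) \in (H :\: P)%SET.
  rewrite -mem_enum mem_nth // -cardE cardsD (finset.setIidPr PH) cardH v2; lia.
by rewrite !inE => /andP[/negPf ->] /= /andP[/eqP -> _].
Qed.

Let sgE i : v 0 (sg i) = (muq m q 0 i)%:~R.
Proof.
case: (boolP (i < m)%N) => im; first exact: sgE_half.
rewrite -{1}(rev_ordK i) sg_rev (dual2_rev _ v_dual) sgE_half ?ltn_rev_ord //.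
have <- : (muq m q 0 i)%:~R + (muq m q 0 (rev_ord i))%:~R = 2 :> R.
  by rewrite -rmorphD /= muq_rev.
by rewrite addrK.
Qed.

(** The map [sg] carries $\mu$ to [v] and commutes with the involution, but may be odd. Since $q<m$,
    $\mu$ is 1 on the middle pair, and precomposing with the transposition of that pair corrects the
    parity without changing the image of $\mu$. *)
Lemma sorted_in_orbit :
  exists2 s, s \in weylD m & v = perm_act s (map_mx intr (muq m q)).
Proof.
have m0 : (m.-1 < m.*2)%N by lia.
pose c := Ordinal m0; pose t := perm sg_inj.
have tE i : t i = sg i by rewrite permE.
have main (u : 'S_(m.*2)) : (forall j, u (rev_ord j) = rev_ord (u j)) -> ~~ odd_perm u ->
    (forall i, v 0 (u i) = (muq m q 0 i)%:~R) ->
    exists2 s, s \in weylD m & v = perm_act s (map_mx intr (muq m q)).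
  move=> ur uo uv; exists u; first by apply/weylDP.
  by apply/rowP => j; rewrite perm_actE mxE -uv permKV.
case: (boolP (odd_perm t)) => ot; last first.
  by apply: (main t) => // i; rewrite !tE ?sgE ?sg_rev.
pose u := (tperm c (rev_ord c) * t)%g.
have tr j : tperm c (rev_ord c) (rev_ord j) = rev_ord (tperm c (rev_ord c) j).
  case: (tpermP c _ j) => [->|->|/eqP h1 /eqP h2]; rewrite ?rev_ordK ?tpermL ?tpermR //.
  by rewrite tpermD // eq_sym ?(inj_eq rev_ord_inj) // rev_ord_eqC.
apply: (main u) => [j||i].
- by rewrite !permM tr !tE sg_rev.
- by rewrite odd_permM odd_tperm ot eq_sym rev_ord_neq.
rewrite permM tE sgE; congr _%:~R.
have cv : muq m q 0 c = 1 by rewrite mxE /= ifF ?ifT //; lia.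
have cv' : muq m q 0 (rev_ord c) = 1 by have := muq_rev qm c; rewrite cv; lia.
by case: tpermP => [->|->|//]; rewrite ?cv ?cv'.
Qed.

End SortOrbit.

(** * Half-integral vectors and the counts in (SP2') *)

Section HalfIntegral.
Variables (R : realType) (m : nat).
Implicit Types v : 'rV[R]_(m.*2).

Lemma half_odd_notin_int (z : int) (x : R) :
  x * 2 = (2 * z + 1)%:~R -> x \isn't a Num.int.
Proof.
move=> h; apply/negP => /intrP[n nx]; move: h; rewrite {}nx -[2]/(2%:~R) -rmorphM /=.
by move=> /eqP; rewrite eqr_int => /eqP; lia.
Qed.

Lemma half_int_cases (x : R) (z : int) : x * 2 = z%:~R -> 0 <= x <= 2 ->
  x \in [:: 0; 2^-1; 1; 3 / 2; 2].
Proof.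
move=> h /andP[x0 x2].
have z0 : (0 <= z)%R by rewrite -(ler_int R); lra.
have z4 : (z <= 4)%R by rewrite -(ler_int R); lra.
have : z \in [:: 0; 1; 2; 3; 4] by rewrite !inE; lia.
have -> : x = z%:~R / 2 by rewrite -h mulfK.
rewrite !inE => /or4P[| | |/orP[]] /eqP ->.
- by rewrite mul0r eqxx.
- by rewrite mul1r eqxx !orbT.
- by rewrite divff // eqxx !orbT.
- by rewrite eqxx !orbT.
- by rewrite (_ : 4%:~R / 2 = 2) ?eqxx ?orbT //; lra.
Qed.

Lemma dist1_half (x : R) : x \in [:: 0; 2^-1; 1; 3 / 2; 2] ->
  `|x - 1| = (x == 2)%:R + (2 - x == 2)%:R + 2^-1 * (x \isn't a Num.int)%:R.
Proof.
have i0 : (0 : R) \is a Num.int by [].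
have i1 : (1 : R) \is a Num.int by [].
have i2 : (2 : R) \is a Num.int by [].
have h1 : (2^-1 : R) \isn't a Num.int by apply: (@half_odd_notin_int 0); lra.
have h3 : (3 / 2 : R) \isn't a Num.int by apply: (@half_odd_notin_int 1); lra.
rewrite !inE => /or4P[| | |/orP[]] /eqP ->.
- by rewrite i0 subr0 eqxx lt_eqF ?ler0_norm //=; lra.
- by rewrite h1 !lt_eqF ?ler0_norm //=; lra.
- by rewrite i1 !lt_eqF ?ger0_norm //=; lra.
- by rewrite h3 !lt_eqF ?ger0_norm //=; lra.
- by rewrite i2 subrr eqxx lt_eqF ?ger0_norm //=; lra.
Qed.

(** The involution exchanges the values 0 and 2, so both occur equally often. Half of the right side
    is the left side of (SP2'). *)
Lemma sum_dist1_half v : dual2 v ->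
  (forall j, v 0 j \in [:: 0; 2^-1; 1; 3 / 2; 2]) ->
  \sum_j `|v 0 j - 1| = 2 * #|[set j | v 0 j == 2]%SET|%:R
    + 2^-1 * #|[set j | v 0 j \isn't a Num.int]%SET|%:R.
Proof.
move=> hv hz.
have cE (B : pred 'I_(m.*2)) : #|[set j | B j]%SET|%:R = \sum_j (B j)%:R :> R.
  rewrite -sum1_card natr_sum big_mkcond; apply: eq_bigr => j _.
  by rewrite inE; case: (B j).
have s2 : \sum_j (v 0 j == 2)%:R = \sum_j (v 0 (rev_ord j) == 2)%:R :> R.
  by rewrite (reindex_inj rev_ord_inj).
rewrite (eq_bigr _ (fun j _ => dist1_half (hz j))) !big_split /= -mulr_sumr.
rewrite !cE; congr (_ + _); rewrite mulr_natl mulr2n; congr (_ + _).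
by rewrite s2; apply: eq_bigr => j _; rewrite (dual2_rev _ hv).
Qed.

End HalfIntegral.

(** * The convex hull of the orbit *)

Section HullOrbit.
Variables (R : realType) (m q : nat).
Hypothesis qm : (q < m)%N.
Implicit Types v : 'rV[R]_(m.*2).

Lemma muq_dual2 : dual2 (map_mx intr (muq m q) : 'rV[R]_(m.*2)).
Proof.
move=> j; rewrite -[RHS]/(2%:~R) -(muq_rev qm j) rmorphD /=.
by congr (_ + _); rewrite mxE.
Qed.

Lemma muq_hullD : hullD q (map_mx intr (muq m q) : 'rV[R]_(m.*2)).
Proof.
have hd := muq_dual2; have hE (j : 'I_(m.*2)) : (j < m)%N ->
    `|(map_mx intr (muq m q) : 'rV[R]_(m.*2)) 0 j - 1| = (j < q)%N%:R.
  by move=> jm; rewrite mxE muq_half // rmorphD /= addrAC subrr add0r ger0_norm;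
    case: (_ < _)%N.
split=> // [j|].
  case: (boolP (j < m)%N) => jm; first by rewrite hE //; case: (_ < _)%N.
  rewrite -dist1_sym -(dual2_rev j hd) hE ?ltn_rev_ord //.
  by case: (_ < _)%N.
rewrite sum_rev_ord (eq_bigr (fun j : 'I_(m.*2) => 2 * (j < q)%N%:R)).
  by rewrite -mulr_sumr sum_half_lt.
by move=> j jm; rewrite (dual2_rev _ hd) dist1_sym hE //; ring.
Qed.

Lemma hullD_perm s v : s \in weylD m -> hullD q v -> hullD q (perm_act s v).
Proof.
move=> sW [h1 h2 h3]; split.
- by move=> j; rewrite !perm_actE (weylD_rev _ (weylDV sW)).
- by move=> j; rewrite perm_actE.
- under eq_bigr do rewrite perm_actE.
  by move: h3; rewrite (reindex_inj (@perm_inj _ s^-1%g)).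
Qed.

(** The region is convex, contains $\mu$ and is stable under the Weyl group. *)
Lemma conv_orbit_sub_hullD : conv_weyl_orbit R m (muq m q) `<=` [set v | hullD q v].
Proof.
apply: smallest_sub; first exact: hullD_convex.
by move=> v [s sW ->]; apply: hullD_perm sW muq_hullD.
Qed.

(* Termination measure for the splitting of a point: both parts have a smaller
   total weight. *)
Definition weight (x : R) : int :=
  if (x == 0) || (x == 2) then 0 else if x == 1 then 1 else 2.

Lemma weight_sym x : weight (2 - x) = weight x.
Proof.
rewrite /weight.
have -> : (2 - x == 0) = (x == 2) by apply/eqP/eqP => ?; lra.
have -> : (2 - x == 2) = (x == 0) by apply/eqP/eqP => ?; lra.
have -> : (2 - x == 1) = (x == 1) by apply/eqP/eqP => ?; lra.
by rewrite orbC.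
Qed.

Lemma weight_ge0 x : (0 <= weight x)%R.
Proof. by rewrite /weight; case: ifP => // _; case: ifP. Qed.

Lemma weight_le2 x : (weight x <= 2)%R.
Proof. by rewrite /weight; case: ifP => // _; case: ifP. Qed.

Lemma weight0 : weight 0 = 0. Proof. by rewrite /weight eqxx. Qed.
Lemma weight2 : weight 2 = 0. Proof. by rewrite /weight eqxx orbT. Qed.
Lemma weight1 : (weight 1 <= 1)%R.
Proof. by rewrite /weight; case: ifP => // _; rewrite eqxx. Qed.

Lemma weight_mid x : `|x - 1| < 1 -> (1 <= weight x)%R.
Proof.
move=> h; rewrite /weight ifF; first by case: ifP.
by apply/negbTE/norP; split; apply/eqP => e; move: h; rewrite e ltNge;
  rewrite ?sub0r ?normrN ?normr1 ?lexx // ger0_norm; lra.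
Qed.

Lemma weight_frac x : 1 < x < 2 -> weight x = 2.
Proof. by move=> h; rewrite /weight !ifF //; apply/negbTE; rewrite ?negb_or;
  [|apply/andP; split]; apply/eqP; lra. Qed.

End HullOrbit.

(** * Splitting points of the region down to the orbit *)

Section HullInConv.
Variables (R : realType) (m q : nat).
Hypothesis qm : (q < m)%N.
Implicit Types v : 'rV[R]_(m.*2).

Variable A : set 'rV[R]_(m.*2).
Hypothesis A_convex : convex_set A.
Hypothesis A_orbit : [set v | exists2 s, s \in weylD m &
  v = perm_act s (map_mx intr (muq m q))] `<=` A.

Let total v : int := \sum_j weight (v 0 j).

Let total_upd v i a : dual2 v ->
  total (upd v i a) = total v + (weight a - weight (v 0 i)) *+ 2.
Proof. by move=> hv; exact: (sum_upd i a (@weight_sym R) hv). Qed.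

Let dist_upd v i a : dual2 v -> \sum_j `|upd v i a 0 j - 1| =
  \sum_j `|v 0 j - 1| + 2 * (`|a - 1| - `|v 0 i - 1|).
Proof. by move=> hv; rewrite (sum_upd i a (@dist1_sym R) hv) -[_ *+ 2]mulr_natl. Qed.

(* A pair of coordinates that has room to reach both 0 and 2 splits the point. *)
Let split_free n v i :
  (forall w, total w < n%:Z -> hullD q w -> A w) ->
  total v < n.+1%:Z -> hullD q v -> `|v 0 i - 1| < 1 ->
  \sum_j `|v 0 j - 1| + 2 * (1 - `|v 0 i - 1|) <= 2 * q%:R -> A v.
Proof.
move=> IH tv [hd h1 hs] vi room.
(* The coordinate is the mean of 2 and 0 with weight [v 0 i / 2] on the value 2; at both ends its
   weight drops to 0. *)
have b : 0 <= v 0 i / 2 <= 1 by move: vi; rewrite ltr_norml; lra.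
rewrite (@upd_comb _ _ v i 2 0 (v 0 i / 2)) //; last by field.
have w1 := weight_mid vi.
apply: convex_set_comb => //; apply: IH; rewrite ?total_upd ?weight0 ?weight2 //.
- by move: tv; lia.
- by apply: upd_hull; rewrite // (_ : 2 - 1 = 1) ?normr1 //; ring.
- by move: tv; lia.
- by apply: upd_hull; rewrite // sub0r normrN normr1.
Qed.

(* Two fractional pairs split the point along a direction that preserves the
   sum of the distances to 1. *)
Let split_pair n v i k :
  (forall w, total w < n%:Z -> hullD q w -> A w) ->
  total v < n.+1%:Z -> hullD q v -> 1 < v 0 i < 2 -> 1 < v 0 k < 2 ->
  k != i -> k != rev_ord i -> A v.
Proof.
move=> IH tv [hd h1 hs] vi vk ki ki'.
pose M t := upd (upd v i (v 0 i + t)) k (v 0 k - t).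
have hdi t : dual2 (upd v i (v 0 i + t)) by exact: upd_dual2.
have Mhull t : 1 <= v 0 i + t <= 2 -> 1 <= v 0 k - t <= 2 -> hullD q (M t).
  move=> ti tk; apply: upd_hull => //.
  - move=> j; rewrite mxE; case: eqVneq => [_|_]; first by rewrite ger0_norm; lra.
    by case: eqVneq => // _; rewrite dist1_sym ger0_norm; lra.
  - by rewrite ger0_norm; lra.
  rewrite dist_upd // upd_out // !ger0_norm; lra.
have Mtot t : total (M t) = total v
    + (weight (v 0 i + t) + weight (v 0 k - t) - 4) *+ 2.
  by rewrite total_upd // total_upd // upd_out // (weight_frac vi) (weight_frac vk); ring.
(* Both coordinates had weight 2, so a sum of at most 3 lowers the total by at least 2. *)
have W (a b : int) : a + b <= 3 -> total v + (a + b - 4) *+ 2 < n%:Z.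
  by move: tv; clear; lia.
(* [t1] and [t2] are the longest moves in the two directions that keep both coordinates in $[1,2]$;
   at the end of each, one coordinate has become 1 or 2. *)
have [t1 [t10 t1i t1k t1E]] : exists t, [/\ 0 < t, t <= 2 - v 0 i,
    t <= v 0 k - 1 & v 0 i + t = 2 \/ v 0 k - t = 1].
  case: (leP (2 - v 0 i) (v 0 k - 1)) => h.
    by exists (2 - v 0 i); split; [lra|lra|lra|left; lra].
  by exists (v 0 k - 1); split; [lra|lra|lra|right; lra].
have [t2 [t20 t2i t2k t2E]] : exists t, [/\ 0 < t, t <= v 0 i - 1,
    t <= 2 - v 0 k & v 0 i - t = 1 \/ v 0 k - - t = 2].
  case: (leP (v 0 i - 1) (2 - v 0 k)) => h.
    by exists (v 0 i - 1); split; [lra|lra|lra|left; lra].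
  by exists (2 - v 0 k); split; [lra|lra|lra|right; lra].
(* With this weight the two moves cancel on average. *)
have [p p01 pt] : exists2 p, 0 <= p <= 1 & p * t1 = (1 - p) * t2.
  have t12 : 0 < t1 + t2 by rewrite addr_gt0.
  exists (t2 / (t1 + t2)); last by field; rewrite gt_eqF.
  by rewrite divr_ge0 ?ler_pdivrMr ?mul1r ?lerDr ?ltW.
have avg x : x = p * (x + t1) + (1 - p) * (x - t2).
  by rewrite -[LHS]addr0 -(subrr (p * t1)) {2}pt; ring.
have avg' x : x = p * (x - t1) + (1 - p) * (x - - t2).
  by rewrite -[LHS]addr0 -(subrr (p * t1)) {1}pt; ring.
have -> : v = p *: M t1 + (1 - p) *: M (- t2).
  apply/rowP => j; rewrite !mxE; case: eqVneq => [->|jk]; first exact: avg'.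
  case: eqVneq => [->|jk'].
    by rewrite (dual2_rev _ hd) [in LHS](avg' (v 0 k)); ring.
  case: eqVneq => [->|ji]; first exact: avg.
  case: eqVneq => [->|ji'].
    by rewrite (dual2_rev _ hd) [in LHS](avg (v 0 i)); ring.
  by ring.
apply: convex_set_comb => //; apply: IH.
- rewrite Mtot; apply: W.
  case: t1E => ->; last exact: le_trans (lerD (weight_le2 _) (weight1 _)) _.
  by rewrite weight2 add0r (le_trans (weight_le2 _)).
- by apply: Mhull; lra.
- rewrite Mtot; apply: W.
  case: t2E => ->; first exact: le_trans (lerD (weight1 _) (weight_le2 _)) _.
  by rewrite weight2 addr0 (le_trans (weight_le2 _)).
- by apply: Mhull; lra.
Qed.

(** Induction on the total weight: a point to which neither splitting applies turns out to have
    entries in $\{0,1,2\}$ with exactly $q$ entries 2. The set [A] is arbitrary because the hull is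
    the intersection of all convex sets containing the orbit. *)
Lemma hullD_sub v : hullD q v -> A v.
Proof.
have [n] : exists n : nat, total v < n%:Z.
  by exists (absz (total v)).+1; lia.
elim: n v => [|n IH] v tv hv.
  have : 0 <= total v by apply: sumr_ge0 => j _; exact: weight_ge0.
  by lia.
have [[i [vi room]]|nofree] := pselect (exists i, `|v 0 i - 1| < 1 /\
  \sum_j `|v 0 j - 1| + 2 * (1 - `|v 0 i - 1|) <= 2 * q%:R).
  exact: split_free IH tv hv vi room.
have tight i : `|v 0 i - 1| < 1 ->
    2 * q%:R < \sum_j `|v 0 j - 1| + 2 * (1 - `|v 0 i - 1|).
  by move=> vi; rewrite ltNge; apply/negP => room; apply: nofree; exists i.
have [hd h1 hs] := hv.
have cases (x : R) : `|x - 1| <= 1 -> x \in [:: 0; 1; 2] \/ 1 < x < 2 \/ 1 < 2 - x < 2.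
  rewrite ler_norml !inE => x1; case: (ltgtP x 1) => [xl|xg|->].
  - by case: (eqVneq x 0) => x0; [left|right; right; lra].
  - by case: (eqVneq x 2) => x2; [left; rewrite !orbT|right; left; lra].
  - by left; rewrite orbT.
have count v' : dual2 v' -> (forall j, v' 0 j \in [:: 0; 1; 2]) ->
    \sum_j `|v' 0 j - 1| = 2 * #|[set j | v' 0 j == 2]%SET|%:R.
  move=> hd' h'; rewrite sum_dist1_half //.
    rewrite [X in _ + _ * X%:R](_ : _ = 0%N) ?mulr0 ?addr0 //.
    apply: eq_card0 => j; rewrite !inE; apply/negbTE; rewrite negbK.
    by have := h' j; rewrite !inE => /or3P[]/eqP->.
  by move=> j; have := h' j; rewrite !inE => /or3P[]->; rewrite ?orbT.
have [[i vi]|nofrac] := pselect (exists i, 1 < v 0 i < 2).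
  have [[k [vk [ki ki']]]|only] := pselect (exists k, 1 < v 0 k < 2 /\
    k != i /\ k != rev_ord i).
    exact: split_pair IH tv hv vi vk ki ki'.
  (* With a single fractional pair, replace it by 1 and let $r$ be the number of entries 2 that
     result. The bound on the sum gives $r<q$, whereas the lack of room at [i] gives $q<r+1$. *)
  have v'012 j : upd v i 1 0 j \in [:: 0; 1; 2].
    rewrite mxE; case: eqVneq => [_|ji]; first by rewrite !inE eqxx orbT.
    case: eqVneq => [_|ji']; first by rewrite !inE addrK eqxx orbT.
    case: (cases _ (h1 j)) => [//|[vj|vj]]; case: only.
      by exists j.
    exists (rev_ord j); rewrite (dual2_rev _ hd); split=> //.
    by rewrite (inj_eq rev_ord_inj) rev_ord_eqC.
  have di : `|v 0 i - 1| = v 0 i - 1 by rewrite ger0_norm; lra.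
  have /tight : `|v 0 i - 1| < 1 by lra.
  have := count _ (upd_dual2 i 1 hd) v'012.
  rewrite dist_upd // subrr normr0 di; set r := #|_| => e h.
  have r1 : q%:R < r%:R + 1 :> R by lra.
  have r2 : r%:R < q%:R :> R by lra.
  by move: r1 r2; rewrite natr1 !ltr_nat; lia.
have v012 j : v 0 j \in [:: 0; 1; 2].
  case: (cases _ (h1 j)) => [//|[vj|vj]]; case: nofrac; first by exists j.
  by exists (rev_ord j); rewrite (dual2_rev _ hd).
have := count _ hd v012; set r := #|_| => e.
apply: A_orbit; apply: sorted_in_orbit => //; apply/eqP; rewrite -/r eqn_leq.
have le_q : (r <= q)%N by rewrite -(ler_nat R); lra.
rewrite le_q /= leqNgt; apply/negP => lt_q.
(* If fewer than $q$ entries are 2, an entry 1 would have room to be split; without entries 1 all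
   distances are 1 and their sum is $2m>2q$. *)
have [[i vi]|none] := pselect (exists i, v 0 i = 1).
  have := tight i; rewrite vi subrr normr0 e => /(_ ltr01).
  have : r%:R + 1 <= q%:R :> R by rewrite natr1 ler_nat.
  by lra.
have : \sum_j `|v 0 j - 1| = \sum_(j < m.*2) 1.
  apply: eq_bigr => j _; have := v012 j; rewrite !inE => /or3P[]/eqP vj.
  - by rewrite vj sub0r normrN normr1.
  - by case: none; exists j.
  - by rewrite vj ger0_norm; lra.
rewrite sumr_const card_ord e -mul2n natrM => h.
have : m%:R <= q%:R :> R by lra.
by rewrite ler_nat leqNgt qm.
Qed.

End HullInConv.

Lemma conv_weyl_orbitE (R : realType) (m q : nat) (v : 'rV[R]_(m.*2)) :
  (q < m)%N -> conv_weyl_orbit R m (muq m q) v <-> hullD q v.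
Proof.
move=> qm; split=> [|hv]; first exact: conv_orbit_sub_hullD.
by move=> A [A_convex A_orbit]; exact: hullD_sub A_convex A_orbit _ hv.
Qed.

(** * Congruences modulo the coroot lattice *)

Section Coroot.
Variable m : nat.
Implicit Types (s : 'S_(m.*2)) (x y : 'rV[int]_(m.*2)).

Lemma corootDP x : corootD m x <-> (forall i, x 0 i + x 0 (rev_ord i) = 0) /\
  (2 %| (\sum_(i < m.*2 | (i < m)%N) x 0 i)%R)%Z.
Proof.
by split=> [[_ h1 h2]|[h1 h2]] //; split=> // i j; rewrite !h1.
Qed.

Lemma corootD_add x y : corootD m x -> corootD m y -> corootD m (x + y).
Proof.
move=> /corootDP[x1 x2] /corootDP[y1 y2]; apply/corootDP; split.
  by move=> i; rewrite !mxE addrACA x1 y1.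
by under eq_bigr do rewrite mxE; rewrite big_split /= rpredD.
Qed.

Lemma corootD_opp x : corootD m x -> corootD m (- x).
Proof.
move=> /corootDP[x1 x2]; apply/corootDP; split.
  by move=> i; rewrite !mxE -opprD x1 oppr0.
by under eq_bigr do rewrite mxE; rewrite sumrN rpredN.
Qed.

Lemma corootD0 : corootD m 0.
Proof.
apply/corootDP; split=> [i|]; first by rewrite !mxE addr0.
by under eq_bigr do rewrite mxE; rewrite big1_eq dvdz0.
Qed.

(** Since $|x|\equiv x$ mod 2, the parity of the half-sum can be read off from the distances to 1.
    This form is invariant under permutations and can be compared with the bound in [hullD]. *)
Lemma corootD_sub_muqP q y : (q < m)%N -> (forall j, y 0 j + y 0 (rev_ord j) = 2) ->
  corootD m (y - muq m q) <->
  exists n : int, \sum_j `|y 0 j - 1| = 2 * q%:Z + 4 * n.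
Proof.
move=> qm hy.
pose a := \sum_(j < m.*2 | (j < m)%N) (y 0 j - 1).
pose b := \sum_(j < m.*2 | (j < m)%N) `|y 0 j - 1|.
have [c ab] : exists c : int, b = a + 2 * c.
  rewrite /a /b; apply: (big_ind2 (fun u v => exists c : int, v = u + 2 * c)).
  - by exists 0.
  - by move=> ? ? ? ? [c ->] [d ->]; exists (c + d); ring.
  - move=> j _; case: (leP 0 (y 0 j - 1)) => h.
      by exists 0; rewrite ger0_norm; lia.
    by exists (1 - y 0 j); rewrite ltr0_norm; lia.
have -> : \sum_j `|y 0 j - 1| = 2 * b.
  rewrite sum_rev_ord mulr_sumr; apply: eq_bigr => j _.
  by have -> : y 0 (rev_ord j) = 2 - y 0 j; [have := hy j; lia|lia].
have E k : (y - muq m q) 0 k = y 0 k - muq m q 0 k.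
  by rewrite mxE [X in _ + X]mxE.
have aE : \sum_(j < m.*2 | (j < m)%N) (y - muq m q) 0 j = a - q%:Z.
  rewrite -[in RHS](natz q) -(sum_half_lt qm) -sumrB; apply: eq_bigr => j jm.
  by rewrite E muq_half //; ring.
split=> [/corootDP[_]|[n nE]].
  by rewrite aE => /dvdzP[n nE]; exists (n + c); lia.
apply/corootDP; split=> [j|]; last first.
  by rewrite aE; apply/dvdzP; exists (n - c); lia.
by rewrite !E; have := hy j; have := muq_rev qm j; lia.
Qed.

(** The sign changes of [s], seen as a signed permutation of the first half. *)
Definition crossing s := [set j : 'I_(m.*2) | (j < m)%N && (m <= s j)%N]%SET.

(** Composing with the transposition of a crossing pair changes the parity and removes one crossing,
    so induction reduces to permutations that preserve the two halves. *)
Lemma odd_perm_crossing s : (forall i, s (rev_ord i) = rev_ord (s i)) ->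
  odd_perm s = odd #|crossing s|.
Proof.
move: {2}#|_| (erefl #|crossing s|) => n.
elim: n s => [|n IH] s cn sr.
  have {}cn : crossing s = finset.set0 by apply: cards0_eq.
  rewrite cn cards0 /=.
  have low j : (s j < m)%N = (j < m)%N.
    have h (k : 'I_(m.*2)) : (k < m)%N -> (s k < m)%N.
      move=> km; have : k \notin crossing s by rewrite cn inE.
      by rewrite inE km /= -ltnNge.
    case: (boolP (j < m)%N) => jm; first exact: h.
    by apply/negbTE; rewrite -ltn_rev_ord -sr h // ltn_rev_ord.
  pose g (j : 'I_(m.*2)) := if (j < m)%N then s j else j.
  have g_inj : injective g.
    move=> i j; rewrite /g; case: ifP => im; case: ifP => jm //.
    - exact: perm_inj.
    - by move=> e; move: (low i); rewrite e im jm.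
    - by move=> e; move: (low j); rewrite -e im jm.
  pose p := perm g_inj; pose r := perm (@rev_ord_inj (m.*2)).
  have rV j : (r^-1)%g j = rev_ord j.
    by apply: (@perm_inj _ r); rewrite permKV permE rev_ordK.
  (* Without crossings, [s] acts by [p] on the first half and by its mirror image on the second, so
     it is even. *)
  have -> : s = (p * p ^ r)%g.
    apply/permP => j; rewrite /conjg !permM rV !permE /g.
    case: (boolP (j < m)%N) => jm.
      by rewrite ltn_rev_ord low jm /= rev_ordK.
    by rewrite ltn_rev_ord jm /= sr rev_ordK.
  by rewrite odd_permM odd_permJ addbb.
have [i ic] : exists i, i \in crossing s by apply/card_gt0P; rewrite cn.
have [im si] : (i < m)%N /\ (m <= s i)%N by move: ic; rewrite inE => /andP.
pose s' := (tperm i (rev_ord i) * s)%g.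
have cs' : crossing s' = (crossing s :\ i)%SET.
  apply/setP => j; rewrite !inE permM; case: tpermP => [->|->|/eqP h1 /eqP h2].
  - by rewrite sr im eqxx /= leqNgt ltn_rev_ord -leqNgt si.
  - by rewrite ltn_rev_ord im andbF.
  - by rewrite h1.
have : odd_perm s' = odd #|crossing s'|.
  apply: IH => [|j].
    by have := cardsD1 i (crossing s); rewrite cs' ic cn; lia.
  rewrite !permM -sr; congr (s _).
  case: (tpermP _ _ j) => [->|->|/eqP h1 /eqP h2]; rewrite ?rev_ordK ?tpermL ?tpermR //.
  by rewrite tpermD // eq_sym ?(inj_eq rev_ord_inj) // rev_ord_eqC.
rewrite odd_permM odd_tperm eq_sym rev_ord_neq cs' => e.
by rewrite (cardsD1 i) ic /= -e negbK.
Qed.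

(* a_m + 1/2, so that w a_m - a_m can be computed over the integers. *)
Definition upper_half : 'rV[int]_(m.*2) := \row_j (m <= j)%N%:Z.

(** On the first half the difference is 1 exactly at the crossings of the inverse of [s], and an
    even permutation has an even number of them. *)
Lemma corootD_perm_upper_half s : s \in weylD m ->
  corootD m (perm_act s upper_half - upper_half).
Proof.
have UE k : upper_half 0 k = 1 - (k < m)%N%:Z.
  by rewrite mxE leqNgt; case: (_ < _)%N.
have E k : (perm_act s upper_half - upper_half) 0 k
    = (k < m)%N%:Z - (s^-1%g k < m)%N%:Z.
  by rewrite mxE [X in _ + X]mxE perm_actE !UE; ring.
move=> /weylDV sW; apply/corootDP; split=> [j|].
  by rewrite !E (weylD_rev _ sW) !ltn_rev_ord; do 2 case: (_ < _)%N.
have /weylDP[os sr] := sW.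
rewrite (eq_bigr (fun j => (m <= s^-1%g j)%N%:R)); last first.
  by move=> j jm; rewrite E jm [(m <= s^-1%g j)%N]leqNgt; case: (_ < _)%N.
have -> : \sum_(j < m.*2 | (j < m)%N) (m <= s^-1%g j)%N%:R
    = #|crossing s^-1%g|%:Z.
  rewrite -sum1_card -natz natr_sum big_mkcond [RHS]big_mkcond.
  by apply: eq_bigr => j _; rewrite inE; do 2 case: (_ <= _)%N.
by rewrite dvdzE /= dvdn2 -odd_perm_crossing.
Qed.

End Coroot.

(** * Reflecting a vertex of the alcove *)

(** Half of this vector leads from $a_0$ to $a_1$ when [c] is the last index, and from $a_m$ to
    $a_{m-1}$ when [c] is the last index of the first half. *)
Definition pair_vec (R : nzRingType) (m : nat) (c : 'I_(m.*2)) : 'rV[R]_(m.*2) :=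
  \row_j ((j == c)%:R - (j == rev_ord c)%:R).
Arguments pair_vec R {m} c.

Lemma pair_vecE (R : nzRingType) (m : nat) (c j : 'I_(m.*2)) :
  pair_vec R c 0 j = (j == c)%:R - (j == rev_ord c)%:R.
Proof. by rewrite mxE. Qed.

Lemma pair_vec_rev (R : nzRingType) (m : nat) (c : 'I_(m.*2)) :
  pair_vec R (rev_ord c) = - pair_vec R c.
Proof. by apply/rowP => j; rewrite !mxE rev_ordK opprB. Qed.

Section Reflection.
Variables (R : realType) (m q : nat).
Hypothesis qm : (q < m)%N.
Variables (y : 'rV[int]_(m.*2)) (c c' : 'I_(m.*2)).

Let yR : 'rV[R]_(m.*2) := map_mx intr y.
Let nu1 := yR + 2^-1 *: (pair_vec R c' - pair_vec R c).
Let nu2 := yR + (pair_vec R c' - pair_vec R c).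

Hypothesis y_hull : hullD q yR.
Hypothesis y_mod : corootD m (y - muq m q).
Hypothesis nu1_hull : hullD q nu1.

Let yRE j : yR 0 j = (y 0 j)%:~R.
Proof. by rewrite mxE. Qed.

Let c_rev (b : 'I_(m.*2)) : (b == rev_ord b) = false.
Proof. by rewrite eq_sym (negPf (rev_ord_neq b)). Qed.

Let y_dual : dual2 yR.
Proof. by case: y_hull. Qed.

Let y_sum j : y 0 j + y 0 (rev_ord j) = 2.
Proof.
by apply/eqP; rewrite -(eqr_int R) rmorphD /= -!yRE y_dual.
Qed.

Let y02 j : (0 <= y 0 j <= 2)%R.
Proof.
case: y_hull => _ /(_ j) h _; move: h; rewrite yRE ler_norml => /andP[h1 h2].
by apply/andP; split; rewrite -(ler_int R); lra.
Qed.

(** Exactly one of [c] and [rev_ord c] lies in the first half, so the half-sum is odd. *)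
Let pair_vec_not_coroot : ~ corootD m (pair_vec int c).
Proof.
move=> /corootDP[_]; rewrite (eq_bigr (fun j => (j == c)%:R - (j == rev_ord c)%:R)); last first.
  by move=> j _; rewrite pair_vecE.
have E b : \sum_(j < m.*2 | (j < m)%N) (j == b)%:R = (b < m)%N%:R :> int.
  rewrite big_mkcond (bigD1 b) //= eqxx big1 ?addr0; first by case: (_ < _)%N.
  by move=> j /negPf ->; rewrite if_same.
by rewrite sumrB !E ltn_rev_ord; case: (c < m)%N.
Qed.

(** Otherwise every entry is 0 or 2, and the distances to 1 add up to $2m>2q$. *)
Let y_has1 : y 0 c = 2 -> exists j, [/\ j != c, j != rev_ord c & y 0 j = 1].
Proof.
move=> yc; apply: contrapT => none.
have : \sum_j `|yR 0 j - 1| = \sum_(j < m.*2) 1.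
  apply: eq_bigr => j _; have : y 0 j != 1.
    apply/eqP => y1; apply: none; exists j; split=> //; apply/eqP => e.
      by move: y1; rewrite e yc.
    by have := y_sum c; rewrite -e y1 yc.
  have := y02 j => h1 h2; have : y 0 j \in [:: 0; 2] by rewrite !inE; lia.
  rewrite yRE !inE => /orP[]/eqP ->; first by rewrite sub0r normrN normr1.
  by rewrite ger0_norm; lra.
case: y_hull => _ _; rewrite sumr_const card_ord => /[swap] ->.
by rewrite -mul2n natrM ler_pM2l // ler_nat leqNgt qm.
Qed.

(** (SP3') in terms of the pair of [c] and its complement; this pair is $A_1$ in one application and
    $B_{m-1}$ in the other. *)
Let SP3_like := (forall j, nu1 0 j \is a Num.int) -> ~ eqmod_corootD nu1 (muq m q) ->
  exists j1 j2, [/\ (j1 == c) || (j1 == rev_ord c),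
    ~~ ((j2 == c) || (j2 == rev_ord c)), nu1 0 j1 = 1 & nu1 0 j2 = 1].

(** Here [nu1] and [nu2] both equal [y], and the right side is void because [y] is congruent to
    $\mu$. *)
Let reflection_id : c' = c -> hullD q nu2 <-> SP3_like.
Proof.
move=> e; rewrite /SP3_like /nu1 /nu2 e subrr scaler0 addr0; split=> // _ _ nmod.
case: nmod; exists (y - muq m q) => //; apply/rowP => j.
by rewrite !mxE rmorphB.
Qed.

Let nu1E j : nu1 0 j = yR 0 j + 2^-1 * (pair_vec R c' 0 j - pair_vec R c 0 j).
Proof. by rewrite /nu1 mxE; congr (_ + _); rewrite mxE; congr (_ * _); rewrite mxE [X in _ + X]mxE. Qed.

Let nu2E j : nu2 0 j = yR 0 j + (pair_vec R c' 0 j - pair_vec R c 0 j).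
Proof. by rewrite /nu2 mxE; congr (_ + _); rewrite mxE [X in _ + X]mxE. Qed.

(** Both sides amount to [y 0 c = 2]: [nu1] is integral and not congruent to $\mu$, while [nu2]
    lowers the entry at [c] by 2, which for the value 2 merely exchanges it with the 0 of its
    partner. *)
Let reflection_flip : c' = rev_ord c -> hullD q nu2 <-> SP3_like.
Proof.
move=> e; have n1E : nu1 = yR - pair_vec R c.
  by rewrite /nu1 e pair_vec_rev -opprD -mulr2n scalerN -scaler_nat scalerA mulVf // scale1r.
have nE j : nu1 0 j = yR 0 j - (j == c)%:R + (j == rev_ord c)%:R.
  by rewrite n1E mxE [X in _ + X]mxE pair_vecE; ring.
have n2E : nu2 = upd yR c (yR 0 c - 2).
  apply/rowP => j; rewrite nu2E e !pair_vecE rev_ordK [RHS]mxE.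
  case: (eqVneq j c) => [->|jc]; first by rewrite c_rev /=; ring.
  by case: (eqVneq j (rev_ord c)) => [->|_]; rewrite ?(dual2_rev _ y_dual) /=; ring.
have cE : nu1 0 c = (y 0 c)%:~R - 1.
  by rewrite nE eqxx c_rev addr0 yRE.
have c'E : nu1 0 (rev_ord c) = 2 - (y 0 c)%:~R + 1.
  by rewrite nE eqxx (negPf (rev_ord_neq _)) subr0 (dual2_rev _ y_dual) yRE.
split=> [[_ /(_ c) h _] _ _|sp].
  have yc : y 0 c = 2.
    have := y02 c; move: h; rewrite nu2E e !pair_vecE rev_ordK eqxx.
    rewrite c_rev yRE /= ler_norml => /andP[h _] ?.
    have : (2 <= y 0 c)%R by rewrite -(ler_int R); lra.
    by lia.
  have [j [j1 j2 yj]] := y_has1 yc; exists c, j.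
  rewrite eqxx negb_or j1 j2 cE nE (negPf j1) (negPf j2) yRE yj yc.
  by split=> //; ring.
have [|[x xQ xE]|j1 [j2 [j1c _ n1 _]]] := sp.
- by move=> j; rewrite nE yRE; apply: rpredD; first apply: rpredB; rewrite ?intr_int ?natr_int.
- apply: pair_vec_not_coroot.
  have -> : pair_vec int c = (y - muq m q) + (- x).
    apply/rowP => j; apply/eqP; rewrite -(eqr_int R).
    move: xE; rewrite n1E => /(congr1 (fun M : 'rV[R]_(m.*2) => M 0 j)).
    rewrite /pair_vec !mxE !rmorphB /= !rmorph_nat => <-.
    by apply/eqP; ring.
  by apply: corootD_add => //; exact: corootD_opp.
have yc : yR 0 c = 2.
  by case/orP: j1c n1 => /eqP ->; rewrite ?cE ?c'E yRE; lra.
rewrite n2E yc; apply: upd_hull => //; first by case: y_hull.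
  by rewrite subrr sub0r normrN normr1.
have -> : `|2 - 2 - 1| - `|yR 0 c - 1| = 0.
  by rewrite yc subrr sub0r normrN normr1 ger0_norm; lra.
by rewrite mulr0 addr0; case: y_hull.
Qed.

(** The entry of [nu1] at [c] is not an integer, so the right side is void, and [nu2] has to be
    shown to lie in the region. Its sum of distances exceeds that of [y] only when [y] is 1 at both
    [c] and [c'], and then by 4. *)
Let reflection_generic : c' != c -> c' != rev_ord c -> hullD q nu2 <-> SP3_like.
Proof.
move=> c1 c2.
have cn : c != rev_ord c by rewrite eq_sym rev_ord_neq.
have cn' : c != rev_ord c' by rewrite -rev_ord_eqC eq_sym.
have pcc : pair_vec R c' 0 c = 0.
  by rewrite pair_vecE (negPf cn') eq_sym (negPf c1) subr0.
have pcc' : pair_vec R c 0 c' = 0 by rewrite pair_vecE (negPf c1) (negPf c2) subr0.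
have pc (b : 'I_(m.*2)) : pair_vec R b 0 b = 1.
  by rewrite pair_vecE eqxx c_rev subr0.
have updE (t : R) : yR + t *: (pair_vec R c' - pair_vec R c) =
    upd (upd yR c (yR 0 c - t)) c' (yR 0 c' + t).
  have E j : (yR + t *: (pair_vec R c' - pair_vec R c)) 0 j =
      yR 0 j + t * (pair_vec R c' 0 j - pair_vec R c 0 j).
    by rewrite mxE; congr (_ + _); rewrite mxE; congr (_ * _); rewrite mxE [X in _ + X]mxE.
  apply/rowP => j; rewrite E !pair_vecE [RHS]mxE.
  case: (eqVneq j c') => [->|jc'].
    rewrite (negPf c1) (negPf c2) c_rev /=; ring.
  case: (eqVneq j (rev_ord c')) => [->|jc2].
    by rewrite (dual2_rev _ y_dual) rev_ord_eqC (inj_eq rev_ord_inj) (negPf c1) (negPf c2) /=; ring.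
  rewrite [RHS]mxE; case: (eqVneq j c) => [->|jc]; first by rewrite (negPf cn) /=; ring.
  by case: (eqVneq j (rev_ord c)) => [->|_]; rewrite ?(dual2_rev _ y_dual) /=; ring.
have sumE (t : R) : \sum_j `|(yR + t *: (pair_vec R c' - pair_vec R c)) 0 j - 1| =
   \sum_j `|yR 0 j - 1| + 2 * (`|yR 0 c - t - 1| - `|yR 0 c - 1|)
     + 2 * (`|yR 0 c' + t - 1| - `|yR 0 c' - 1|).
  rewrite updE (sum_upd _ _ (@dist1_sym R)); last exact: upd_dual2.
  rewrite (sum_upd _ _ (@dist1_sym R)) // upd_out //.
  by ring.
have nu1U : nu1 = upd (upd yR c (yR 0 c - 2^-1)) c' (yR 0 c' + 2^-1) by rewrite -updE.
have nu2E1 : nu2 = yR + 1 *: (pair_vec R c' - pair_vec R c) by rewrite scale1r.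
have [_ n1b n1s] := nu1_hull; have [_ _ ys] := y_hull.
have n1c : nu1 0 c = yR 0 c - 2^-1 by rewrite nu1E pcc pc; ring.
have n1c' : nu1 0 c' = yR 0 c' + 2^-1 by rewrite nu1E pcc' pc; ring.
have yc : y 0 c = 1 \/ y 0 c = 2.
  have := n1b c; rewrite n1c yRE ler_norml => /andP[h _].
  have h1 : (0 < y 0 c)%R by rewrite -(ltr_int R); lra.
  by have := y02 c; lia.
have yc' : y 0 c' = 0 \/ y 0 c' = 1.
  have := n1b c'; rewrite n1c' yRE ler_norml => /andP[_ h].
  have h1 : (y 0 c' < 2)%R by rewrite -(ltr_int R); lra.
  by have := y02 c'; lia.
split=> [_ int_n1 _|_].
  have := int_n1 c; rewrite (negPf (@half_odd_notin_int R (y 0 c - 1) _ _)) //.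
  by rewrite n1c yRE rmorphD rmorphM rmorphB /=; field.
rewrite nu2E1 updE.
have a01 : `|yR 0 c - 1 - 1| <= 1 /\ `|yR 0 c' + 1 - 1| <= 1.
  by rewrite !yRE !ler_norml; case: yc => ->; case: yc' => ->; lra.
split.
- exact/upd_dual2/upd_dual2.
- move=> j; rewrite mxE; case: eqVneq => [_|_]; first by case: a01.
  case: eqVneq => [_|_]; first by rewrite dist1_sym; case: a01.
  rewrite mxE; case: eqVneq => [_|_]; first by case: a01.
  case: eqVneq => [_|_]; first by rewrite dist1_sym; case: a01.
  by case: y_hull.
rewrite -updE sumE.
have := n1s; rewrite /nu1 sumE.
have [n nE] := (corootD_sub_muqP qm y_sum).1 y_mod.
have SE : \sum_j `|yR 0 j - 1| = 2 * q%:R + 4 * n%:~R.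
  transitivity ((\sum_j `|y 0 j - 1|)%:~R : R).
    by rewrite rmorph_sum /=; apply: eq_bigr => j _; rewrite yRE intr_norm rmorphB.
  by rewrite nE rmorphD !rmorphM.
have n0 : (n <= 0)%R by rewrite -(ler_int R); move: ys; rewrite SE; lra.
(* By the congruence the sum of distances is $2q+4n$, so the room for 2 provided by [nu1] is already
   room for 4. *)
have n1 : 2 * q%:R + 4 * n%:~R + 2 <= 2 * q%:R :> R -> n%:~R <= -1 :> R.
  move=> h; rewrite -[-1]/((-1)%:~R) ler_int.
  have : (n < 0)%R by rewrite -(ltr_int R); lra.
  by lia.
have {}n0 : n%:~R <= 0 :> R by rewrite -[0]/(0%:~R) ler_int.
(* The distances of [y] to 1 at [c] and [c'] are $e,f\in\{0,1\}$; the full move turns them into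
   $1-e$, $1-f$, and half-way both are $\frac12$. *)
have [e [e01 e1 e2 e3]] : exists e, [/\ e = 0 \/ e = 1, `|yR 0 c - 2^-1 - 1| = 2^-1,
    `|yR 0 c - 1| = e & `|yR 0 c - 1 - 1| = 1 - e].
  rewrite yRE; case: yc => ->; [exists 0|exists 1]; split; first by left.
  - by rewrite ler0_norm; lra.
  - by rewrite subrr normr0.
  - by rewrite ler0_norm; lra.
  - by right.
  - by rewrite ger0_norm; lra.
  - by rewrite ger0_norm; lra.
  - by rewrite ger0_norm; lra.
have [f [f01 f1 f2 f3]] : exists e, [/\ e = 0 \/ e = 1, `|yR 0 c' + 2^-1 - 1| = 2^-1,
    `|yR 0 c' - 1| = e & `|yR 0 c' + 1 - 1| = 1 - e].
  rewrite yRE; case: yc' => ->; [exists 1|exists 0]; split; first by right.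
  - by rewrite ler0_norm; lra.
  - by rewrite ler0_norm; lra.
  - by rewrite ger0_norm; lra.
  - by left.
  - by rewrite ger0_norm; lra.
  - by rewrite subrr normr0.
  - by rewrite ger0_norm; lra.
rewrite SE e1 e2 e3 f1 f2 f3.
clear yc yc' a01 e1 e2 e3 f1 f2 f3; case: e01 f01 => -> [] -> h; last by lra.
- by have /n1 : 2 * q%:R + 4 * n%:~R + 2 <= 2 * q%:R :> R; lra.
- by lra.
- by lra.
Qed.

(* To be read with c' the image of c under w: y, nu1 and nu2 are the displacements
   by w of a vertex a, of a + pair_vec c / 2 and of a + pair_vec c. *)
Lemma reflected_hullDP : hullD q nu2 <->
  ((forall j, nu1 0 j \is a Num.int) -> ~ eqmod_corootD nu1 (muq m q) ->
   exists j1 j2, [/\ (j1 == c) || (j1 == rev_ord c),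
    ~~ ((j2 == c) || (j2 == rev_ord c)), nu1 0 j1 = 1 & nu1 0 j2 = 1]).
Proof.
case: (eqVneq c' c) => [|c1]; first exact: reflection_id.
case: (eqVneq c' (rev_ord c)) => [|c2]; first exact: reflection_flip.
exact: reflection_generic.
Qed.

End Reflection.

(** * Displacements $wv-v$ and the points $a_k$ *)

Section Displacement.
Variables (R : realType) (m : nat) (w : affperm m.*2).
Implicit Types v : 'rV[R]_(m.*2).

Definition disp v : 'rV[R]_(m.*2) :=
  \row_j ((w.1 0 j)%:~R + v 0 (w.2^-1%g j) - v 0 j).

Lemma dispE v j : disp v 0 j = (w.1 0 j)%:~R + v 0 (w.2^-1%g j) - v 0 j.
Proof. by rewrite mxE. Qed.

Lemma affact_disp v : affact w v - v = disp v.
Proof.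
by apply/rowP => j; rewrite dispE /affact !row_linE perm_actE mxE.
Qed.

Lemma disp_sum n (a : 'I_n -> R) (x : 'I_n -> 'rV[R]_(m.*2)) :
  \sum_i a i = 1 -> disp (\sum_i a i *: x i) = \sum_i a i *: disp (x i).
Proof.
move=> a1; apply/rowP => j; rewrite dispE !summxE.
have -> : (w.1 0 j)%:~R = \sum_i a i * (w.1 0 j)%:~R by rewrite -mulr_suml a1 mul1r.
rewrite -big_split -sumrB /=; apply: eq_bigr => i _.
by rewrite !row_linE dispE; ring.
Qed.

Lemma disp_mix t v v' :
  disp ((1 - t) *: v + t *: v') = (1 - t) *: disp v + t *: disp v'.
Proof.
by apply/rowP => j; rewrite dispE !row_linE !dispE; ring.
Qed.

Lemma disp_const a v : disp (const_mx a + v) = disp v.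
Proof. by apply/rowP => j; rewrite !dispE !mxE; ring. Qed.

Lemma disp_pair_vec t c v : w.2 \in weylD m ->
  disp (v + t *: pair_vec R c) =
    disp v + t *: (pair_vec R (w.2 c) - pair_vec R c).
Proof.
move=> wW; have pE j : pair_vec R c 0 (w.2^-1%g j) = pair_vec R (w.2 c) 0 j.
  by rewrite !pair_vecE !(can2_eq (permKV w.2) (permK w.2)) (weylD_rev _ wW).
by apply/rowP => j; rewrite dispE !row_linE dispE pE; ring.
Qed.

(** The displacement at $a_m$: this point differs from [upper_half] by a constant vector, which does
    not affect displacements. *)
Definition nu_top : 'rV[int]_(m.*2) := w.1 + (perm_act w.2 (upper_half m) - upper_half m).

Lemma nuvec_0 : nuvec R w 0 = map_mx intr w.1.
Proof.
apply/rowP => j; rewrite /nuvec affact_disp dispE !mxE !ltn0 subn0 !ltn_ord.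
by rewrite addr0 subr0.
Qed.

Lemma nuvec_top : nuvec R w m = map_mx intr nu_top.
Proof.
have fE j : face_point R m m 0 j = (upper_half m 0 j)%:~R - 2^-1.
  have e : (m.*2 - m = m)%N by lia.
  by rewrite !mxE e [(m <= j)%N]leqNgt; case: (_ < _)%N => /=; lra.
apply/rowP => j; rewrite /nuvec affact_disp dispE !fE [RHS]mxE.
rewrite !row_linE perm_actE.
by rewrite !rmorphD rmorphN /=; ring.
Qed.

Lemma nuvec_half_int k j : exists z : int, nuvec R w k 0 j * 2 = z%:~R.
Proof.
have fE i : exists z : int, face_point R m k 0 i * 2 = z%:~R.
  rewrite mxE; case: ifP => _; first by exists (-1); lra.
  by case: ifP => _; [exists 0|exists 1]; lra.
have [a aE] := fE (w.2^-1%g j); have [b bE] := fE j.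
exists (w.1 0 j * 2 + a - b); rewrite /nuvec affact_disp dispE.
by rewrite !rmorphD rmorphN rmorphM /= -aE -bE; ring.
Qed.

(** (SP1') confines the half-integral entries to $0,\frac12,1,\frac32,2$, where the sum of distances
    to 1 is twice the left side of (SP2'). *)
Lemma SP12_hullD q k : SP1 (nuvec R w k) /\ SP2 q (nuvec R w k) <->
  hullD q (nuvec R w k).
Proof.
set nu := nuvec R w k.
have cases j : 0 <= nu 0 j <= 2 -> nu 0 j \in [:: 0; 2^-1; 1; 3 / 2; 2].
  by have [z zE] := nuvec_half_int k j; exact: half_int_cases zE.
have n02 j : (0 <= nu 0 j <= 2) = (`|nu 0 j - 1| <= 1).
  by rewrite ler_norml; apply/idP/idP => /andP[? ?]; apply/andP; split; lra.
have SP2E : dual2 nu -> (forall j, `|nu 0 j - 1| <= 1) ->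
    SP2 q nu <-> \sum_j `|nu 0 j - 1| <= 2 * q%:R.
  move=> hd h1; rewrite sum_dist1_half // => [|j]; last by apply: cases; rewrite n02.
  by rewrite /SP2; split=> h; lra.
split=> [[[hd h02] h2]|[hd h1 hs]].
  have hd' : dual2 nu.
    move=> j; have := congr1 (fun M : 'rV[R]_(m.*2) => M 0 j) hd.
    by rewrite mxE [X in _ + X]mxE [RHS]mxE.
  have h1 j : `|nu 0 j - 1| <= 1 by rewrite -n02.
  by split=> //; apply/SP2E.
split; last exact/SP2E; split=> [|j]; last by rewrite n02.
by apply/rowP => j; rewrite mxE [X in _ + X]mxE [RHS]mxE; exact: hd.
Qed.

Lemma face_point_1 (c : 'I_(m.*2)) : c = m.*2.-1 :> nat ->
  face_point R m 1 = face_point R m 0 + 2^-1 *: pair_vec R c.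
Proof.
move=> cE; apply/rowP => j; rewrite !row_linE pair_vecE !mxE ltn0 subn0 ltn_ord.
have jm := ltn_ord j; rewrite -!(inj_eq val_inj) /= cE.
have [h1|h1] := ltnP j 1.
  have -> : (j == m.*2.-1 :> nat) = false by lia.
  have -> : (j == m.*2 - (m.*2.-1).+1 :> nat)%N by lia.
  by rewrite /=; lra.
have -> : (j == m.*2 - (m.*2.-1).+1 :> nat)%N = false by lia.
have [h2|h2] := ltnP j (m.*2 - 1).
  have -> : (j == m.*2.-1 :> nat) = false by lia.
  by rewrite /=; lra.
have -> : (j == m.*2.-1 :> nat) by lia.
by rewrite /=; lra.
Qed.

Lemma face_point_pred (c : 'I_(m.*2)) : c = m.-1 :> nat ->
  face_point R m m.-1 = face_point R m m + 2^-1 *: pair_vec R c.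
Proof.
move=> cE; apply/rowP => j; rewrite !row_linE pair_vecE !mxE.
have jm := ltn_ord j; have cm := ltn_ord c; rewrite -!(inj_eq val_inj) /= cE.
have -> : (j < m.*2 - m)%N = (j < m)%N by lia.
have [h1|h1] := ltnP j m.-1.
  have -> : (j < m)%N by lia.
  have -> : (j == m.-1 :> nat) = false by lia.
  have -> : (j == m.*2 - m.-1.+1 :> nat)%N = false by lia.
  by rewrite /=; lra.
have [h2|h2] := ltnP j m.
  have -> : (j < m.*2 - m.-1)%N by lia.
  have -> : (j == m.-1 :> nat) by lia.
  have -> : (j == m.*2 - m.-1.+1 :> nat)%N = false by lia.
  by rewrite /=; lra.
have -> : (j == m.-1 :> nat) = false by lia.
have [h3|h3] := ltnP j (m.*2 - m.-1).
  have -> : (j == m.*2 - m.-1.+1 :> nat)%N by lia.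
  by rewrite /=; lra.
have -> : (j == m.*2 - m.-1.+1 :> nat)%N = false by lia.
by rewrite /=; lra.
Qed.

Lemma outer_idx_1 (c j : 'I_(m.*2)) : c = m.*2.-1 :> nat ->
  (j \in outer_idx m 1) = (j == c) || (j == rev_ord c).
Proof.
move=> cE; rewrite inE -!(inj_eq val_inj) /= cE.
by have := ltn_ord j; lia.
Qed.

Lemma inner_idx_1 (c j : 'I_(m.*2)) : c = m.*2.-1 :> nat ->
  (j \in inner_idx m 1) = ~~ ((j == c) || (j == rev_ord c)).
Proof.
move=> cE; rewrite inE -!(inj_eq val_inj) /= cE.
by have := ltn_ord j; lia.
Qed.

Lemma inner_idx_pred (c j : 'I_(m.*2)) : c = m.-1 :> nat ->
  (j \in inner_idx m m.-1) = (j == c) || (j == rev_ord c).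
Proof.
move=> cE; rewrite inE -!(inj_eq val_inj) /= cE.
by have := ltn_ord j; lia.
Qed.

Lemma outer_idx_pred (c j : 'I_(m.*2)) : c = m.-1 :> nat ->
  (j \in outer_idx m m.-1) = ~~ ((j == c) || (j == rev_ord c)).
Proof.
move=> cE; rewrite inE -!(inj_eq val_inj) /= cE.
by have := ltn_ord j; lia.
Qed.

End Displacement.

(** * Congruence to $\mu$ and the conditions (SP3') *)

Section Cosets.
Variables (R : realType) (m q : nat) (w : affperm m.*2).
Hypotheses (qm : (q < m)%N) (wX : extWeylD m w).

(** The criterion by the sum of distances to 1 does not see the order of the entries. *)
Lemma corootD_perm_muq s : s \in weylD m ->
  corootD m (perm_act s (muq m q) - muq m q).
Proof.
move=> sW; apply/corootD_sub_muqP => // [j|].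
  by rewrite !perm_actE (weylD_rev _ (weylDV sW)) muq_rev.
have [n ->] : exists n : int, \sum_j `|perm_act s (muq m q) 0 j - 1| = 2 * q%:Z + 4 * n.
  under eq_bigr do rewrite perm_actE.
  rewrite (reindex_inj (@perm_inj _ s)); under eq_bigr do rewrite permK.
  apply/(corootD_sub_muqP qm) => [j|]; first exact: muq_rev.
  by rewrite subrr; exact: corootD0.
by exists n.
Qed.

(** The Weyl group fixes $\mu$ modulo the coroot lattice, so the translation part alone decides. *)
Lemma eqmod_affWeylDP :
  eqmod_affWeylD w (transl (muq m q)) <-> corootD m (w.1 - muq m q).
Proof.
case: wX; case: w => l s /= lX sW.
have sQ := corootD_perm_muq sW.
split=> [[[k t] [/= kQ tW]]|lQ].
  rewrite /affmul /= mul1g => -[-> _].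
  rewrite -addrA; apply: corootD_add => //; exact: corootD_perm_muq.
exists (l - perm_act s (muq m q), s).
  split=> //=; rewrite -(subrKA (muq m q)); apply: corootD_add => //.
  by rewrite -opprB; exact: corootD_opp.
by rewrite /affmul /= mul1g subrK.
Qed.

Lemma eqmod_corootD_intr y :
  eqmod_corootD (map_mx intr y : 'rV[R]_(m.*2)) (muq m q) <-> corootD m (y - muq m q).
Proof.
split=> [[x xQ /rowP xE]|yQ]; last first.
  by exists (y - muq m q) => //; apply/rowP => j; rewrite !mxE rmorphB.
suff -> : y - muq m q = x by [].
apply/rowP => j; apply/eqP; rewrite -(eqr_int R); apply/eqP; move: (xE j).
rewrite row_linE [(- map_mx _ _) 0 j]row_oppE ![map_mx _ _ _ _]mxE => <-.
by rewrite !row_linE rmorphB.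
Qed.

(** $A_0$ is empty, so the required index cannot exist and the condition forces the congruence. *)
Lemma SP3_0 : SP3 q 0 (nuvec R w 0) <-> corootD m (w.1 - muq m q).
Proof.
rewrite /SP3 nuvec_0 eqmod_corootD_intr; split=> [h|h _ /(_ h)//].
apply: contrapT => /(h _)[|j1 [j2 [+ _ _ _]]].
  by move=> j; rewrite mxE intr_int.
by rewrite inE /= subn0 leqNgt ltn_ord.
Qed.

Lemma nu_top_eqmod : corootD m (w.1 - muq m q) -> corootD m (nu_top w - muq m q).
Proof.
move=> lQ; rewrite /nu_top addrAC; apply: corootD_add => //.
by case: wX => _; exact: corootD_perm_upper_half.
Qed.

Lemma SP3_top : corootD m (w.1 - muq m q) -> SP3 q m (nuvec R w m).
Proof.
by move=> lQ _; case; rewrite nuvec_top; apply/eqmod_corootD_intr/nu_top_eqmod.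
Qed.

(** $a_1$ is the midpoint of $a_0$ and its reflection, and $A_1$ is the pair of the last index [c];
    the reflection criterion applies with [w.2 c] as the image of [c]. *)
Lemma SP3_1 (c : 'I_(m.*2)) : c = m.*2.-1 :> nat ->
  corootD m (w.1 - muq m q) -> hullD q (nuvec R w 0) -> hullD q (nuvec R w 1) ->
  hullD q (disp w (face_point R m 0 + pair_vec R c)) <-> SP3 q 1 (nuvec R w 1).
Proof.
move=> cE lQ h0 h1; have [_ wW] := wX.
have E1 : nuvec R w 1 = map_mx intr w.1 +
    2^-1 *: (pair_vec R (w.2 c) - pair_vec R c).
  by rewrite /nuvec affact_disp (face_point_1 _ cE) disp_pair_vec // -affact_disp -nuvec_0.
rewrite -[pair_vec R c]scale1r disp_pair_vec // scale1r -affact_disp.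
rewrite -[_ - face_point _ _ _]/(nuvec R w 0) nuvec_0 (reflected_hullDP qm) //.
- rewrite -E1 /SP3; split=> h i1 n1.
    have [j1 [j2 [c1 c2 e1 e2]]] := h i1 n1; exists j1, j2; move: c1 c2.
    by rewrite (outer_idx_1 _ cE) (inner_idx_1 _ cE).
  have [j1 [j2 [c1 c2 e1 e2]]] := h i1 n1; exists j1, j2; move: c1 c2.
  by rewrite (outer_idx_1 _ cE) (inner_idx_1 _ cE).
- by rewrite -nuvec_0.
- by rewrite -E1.
Qed.

(** The same argument from $a_m$ through $a_{m-1}$. The pair of [c] is now the inner set $B_{m-1}$,
    so the two witnesses exchange roles. *)
Lemma SP3_pred (c : 'I_(m.*2)) : c = m.-1 :> nat ->
  corootD m (w.1 - muq m q) -> hullD q (nuvec R w m) -> hullD q (nuvec R w m.-1) ->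
  hullD q (disp w (face_point R m m + pair_vec R c)) <-> SP3 q m.-1 (nuvec R w m.-1).
Proof.
move=> cE lQ h0 h1; have [_ wW] := wX.
have E1 : nuvec R w m.-1 = map_mx intr (nu_top w) +
    2^-1 *: (pair_vec R (w.2 c) - pair_vec R c).
  by rewrite /nuvec affact_disp (face_point_pred _ cE) disp_pair_vec // -affact_disp -nuvec_top.
rewrite -[pair_vec R c]scale1r disp_pair_vec // scale1r -affact_disp.
rewrite -[_ - face_point _ _ _]/(nuvec R w m) nuvec_top (reflected_hullDP qm) //.
- rewrite -E1 /SP3; split=> h i1 n1.
    have [j1 [j2 [c1 c2 e1 e2]]] := h i1 n1; exists j2, j1; move: c1 c2.
    by rewrite (outer_idx_pred _ cE) (inner_idx_pred _ cE).
  have [j1 [j2 [c1 c2 e1 e2]]] := h i1 n1; exists j2, j1; move: c1 c2.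
  by rewrite (outer_idx_pred _ cE) (inner_idx_pred _ cE).
- by rewrite -nuvec_top.
- exact: nu_top_eqmod.
- by rewrite -E1.
Qed.

End Cosets.

(** * The base alcove *)

Lemma entry_ord (V : nmodType) (n : nat) (v : 'rV[V]_n) (j : 'I_n) (i : nat) :
  i.-1 = j -> entry v i = v 0 j.
Proof. by move=> e; rewrite /entry e valK. Qed.

Section Alcove.
Variables (R : realType) (m : nat).
Hypothesis m2 : (2 <= m)%N.
Implicit Types v u : 'rV[R]_(m.*2).

(* The last inequality follows from the others unless m = 2; with it, both
   cases of [base_alcoveD] have the same shape. *)
Definition alcove_ineqs (r : rel R) v :=
  [/\ r (entry v 1) (entry v 2), r (entry v m.*2 - 1) (entry v 2),
      (forall j, (2 <= j)%N -> (j.+1 <= m.-1)%N -> r (entry v j) (entry v j.+1)),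
      r (entry v m.-1) (entry v m) &
      r (entry v m.-1) (entry v m.+1) /\ r (entry v m.*2 - 1) (entry v m.+1)].

Lemma base_alcoveDP v : base_alcoveD R m v <->
  apartment R m v /\ alcove_ineqs <%R v.
Proof.
rewrite /base_alcoveD /alcove_ineqs /=; case: eqVneq => [mE|mn2] /=.
  have E i j : i = j -> entry v i = entry v j by move=> ->.
  rewrite (E m.*2 4) ?(E m.-1 1) ?(E m 2) ?(E m.+1 3); try by rewrite mE.
  split=> [[vA [h1 h2 h3 h4]]|[vA [h1 h2 _ _ [h3 h4]]]]; split=> //.
  by split=> // j ? ?; exfalso; lia.
split=> [[vA [h1 h2 h3 h4 h5]]|[vA [h1 h2 h3 h4 [h5 _]]]]; split=> //.
(* For $m\ge3$ the extra inequality comes from the chain $x_{2m}-1<x_2\le\dots\le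
   x_{m-1}<x_{m+1}$. *)
split=> //; split=> //; apply: lt_trans h5; apply: lt_le_trans h2 _.
suff h k : (k.+2 <= m.-1)%N -> entry v 2 <= entry v k.+2.
  by rewrite (_ : m.-1 = (m - 3).+2); [apply: h; lia|lia].
elim: k => [//|k IH] km; apply: le_trans (IH _) (ltW (h3 _ _ _)) => //; lia.
Qed.

Lemma entry_mix (t : R) v u j :
  entry ((1 - t) *: v + t *: u) j = (1 - t) * entry v j + t * entry u j.
Proof.
by rewrite /entry; case: insubP => [i _ _|_] /=; rewrite ?row_linE //; ring.
Qed.

(** A step from a point of the closed alcove towards an interior one makes all inequalities strict;
    this approximates the vertices from inside. *)
Lemma alcove_ineqs_mix (t : R) v u : 0 < t <= 1 ->
  alcove_ineqs <=%R v -> alcove_ineqs <%R u ->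
  alcove_ineqs <%R ((1 - t) *: v + t *: u).
Proof.
move=> /andP[t0 t1].
have mix a b c d : a <= b -> c < d -> (1 - t) * a + t * c < (1 - t) * b + t * d.
  by move=> ab cd; rewrite ler_ltD ?ler_wpM2l ?ltr_pM2l // subr_ge0.
have mix1 a b c d : a - 1 <= b -> c - 1 < d ->
    (1 - t) * a + t * c - 1 < (1 - t) * b + t * d.
  move=> ab cd; have := mix _ _ _ _ ab cd.
  by rewrite !mulrBr; lra.
move=> [v1 v2 v3 v4 [v5 v6]] [u1 u2 u3 u4 [u5 u6]].
split; rewrite ?entry_mix; [exact: mix|exact: mix1| |exact: mix|].
  by move=> j j1 j2; rewrite !entry_mix; apply: mix; [exact: v3|exact: u3].
by split; [exact: mix|exact: mix1].
Qed.

Lemma apartment_mix (t : R) v u : apartment R m v -> apartment R m u ->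
  apartment R m ((1 - t) *: v + t *: u).
Proof.
move=> /apartmentP hv /apartmentP hu; apply/apartmentP => i j; rewrite !row_linE.
by have := hv i j; have := hu i j; nra.
Qed.

(** An interior point of the alcove, with equally spaced entries in $[0,1)$. *)
Definition alcove_pt : 'rV[R]_(m.*2) := \row_j (j%:R / m.*2%:R).

Lemma entry_row (F : nat -> R) i : (i.-1 < m.*2)%N ->
  entry (\row_(j < m.*2) F j) i = F i.-1.
Proof. by move=> im; rewrite (@entry_ord _ _ _ (Ordinal im)) // mxE. Qed.

Lemma alcove_pt_in : apartment R m alcove_pt /\ alcove_ineqs <%R alcove_pt.
Proof.
have M0 : 0 < m.*2%:R :> R by rewrite ltr0n; lia.
split.
  apply/apartmentP => i j; rewrite !mxE -!mulrDl -!natrD /=.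
  by congr (_%:R / _); have := ltn_ord i; have := ltn_ord j; lia.
have mono i j : (i.-1 < j.-1)%N -> (j.-1 < m.*2)%N ->
    entry alcove_pt i < entry alcove_pt j.
  move=> ij jm; rewrite !(@entry_row (fun k => k%:R / m.*2%:R)) //; last by lia.
  by rewrite ltr_pM2r ?invr_gt0 // ltr_nat.
have top j : (j.-1 < m.*2)%N -> entry alcove_pt m.*2 - 1 < entry alcove_pt j.
  move=> jm; rewrite !(@entry_row (fun k => k%:R / m.*2%:R)) //; last by lia.
  apply: (@lt_le_trans _ _ 0); last by rewrite divr_ge0.
  by rewrite subr_lt0 ltr_pdivrMr // mul1r ltr_nat; lia.
split; try by [apply: mono; lia|apply: top; lia].
  by move=> j j1 j2; apply: mono; lia.
by split; [apply: mono; lia|apply: top; lia].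
Qed.

Lemma apartment_dual a v : (forall j, v 0 j + v 0 (rev_ord j) = a) -> apartment R m v.
Proof. by move=> h; apply/apartmentP => i j; rewrite !h. Qed.

Lemma face_point_rev k j : (k <= m)%N ->
  face_point R m k 0 j + face_point R m k 0 (rev_ord j) = 0.
Proof.
move=> km; rewrite !mxE /=; have jm := ltn_ord j.
have [h1|h1] := ltnP j k.
  have -> : (m.*2 - j.+1 < k)%N = false by lia.
  have -> : (m.*2 - j.+1 < m.*2 - k)%N = false by lia.
  by lra.
have -> : (m.*2 - j.+1 < m.*2 - k)%N by lia.
have [h2|h2] := ltnP j (m.*2 - k).
  have -> : (m.*2 - j.+1 < k)%N = false by lia.
  by lra.
have -> : (m.*2 - j.+1 < k)%N by lia.
by lra.
Qed.

Lemma pair_vec_rev_sum (c j : 'I_(m.*2)) :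
  pair_vec R c 0 j + pair_vec R c 0 (rev_ord j) = 0.
Proof. by rewrite !pair_vecE rev_ord_eqC (inj_eq rev_ord_inj); ring. Qed.

Lemma face_point_closed k : (k <= m)%N -> alcove_ineqs <=%R (face_point R m k).
Proof.
move=> km; pose F j : R := if (j < k)%N then - 2^-1 else if (j < m.*2 - k)%N then 0 else 2^-1.
have mono i j : (i.-1 <= j.-1)%N -> (j.-1 < m.*2)%N ->
    entry (face_point R m k) i <= entry (face_point R m k) j.
  move=> ij jm; rewrite !(@entry_row F) //; last by lia.
  rewrite /F; have [h1|h1] := ltnP i.-1 k.
    by case: ifP => _; [|case: ifP => _]; lra.
  have -> : (j.-1 < k)%N = false by lia.
  have [h2|h2] := ltnP i.-1 (m.*2 - k); first by case: ifP => _; lra.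
  by have -> : (j.-1 < m.*2 - k)%N = false by lia.
have top j : (j.-1 < m.*2)%N ->
    entry (face_point R m k) m.*2 - 1 <= entry (face_point R m k) j.
  move=> jm; rewrite !(@entry_row F) //; last by lia.
  by rewrite /F; do ?[case: ifP => _]; lra.
split; try by [apply: mono; lia|apply: top; lia].
  by move=> j j1 j2; apply: mono; lia.
by split; [apply: mono; lia|apply: top; lia].
Qed.

End Alcove.

(** * Barycentric coordinates on the closed alcove *)

Lemma sum_tail (V : zmodType) (F : nat -> V) (n j : nat) :
  (j <= n)%N -> F n.+1 = 0 ->
  \sum_(k < n.+1) (if (j < k)%N then F k - F k.+1 else 0) = F j.+1.
Proof.
move=> jn F0.
rewrite -(big_mkord predT (fun k => if (j < k)%N then F k - F k.+1 else 0)).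
rewrite (big_cat_nat _ (n := j.+1)) //= [X in X + _]big_nat big1 ?add0r; last first.
  by move=> k /andP[_ kj]; rewrite ifF // ltnNge -ltnS kj.
rewrite big_nat (eq_bigr (fun k => - (F k.+1 - F k))); last first.
  by move=> k /andP[jk _]; rewrite jk opprB.
by rewrite sumrN -big_nat telescope_sumr ?F0 ?sub0r ?opprK.
Qed.

Section Fold.
Variables (R : realType) (m : nat).
Hypothesis m2 : (2 <= m)%N.

(** The folded point has coordinates $F_1,\dots,F_m$, framed by the wall values $F_0=-\frac12$ and
    $F_{m+1}=0$. The maximum reflects in $x_1=-\frac12$ and the minimum in $x_m=0$; the folded point
    is in the simplex when the sequence is nondecreasing. *)
Definition fold_coord (u : nat -> R) k : R := if k is k'.+1 then
    if k' == 0%N then Num.max (u 0%N) (- 1 - u 0%N)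
    else if k' == m.-1 then Num.min (u m.-1) (- u m.-1)
    else if (k' < m)%N then u k' else 0
  else - 2^-1.

Lemma fold_coord_mono (u : nat -> R) k : (k <= m)%N ->
  u 0%N <= u 1%N -> - 1 - u 0%N <= u 1%N ->
  (forall i, (0 < i)%N -> (i.+1 < m.-1)%N -> u i <= u i.+1) ->
  u m.-2 <= u m.-1 -> u m.-2 <= - u m.-1 -> - 1 - u 0%N <= - u m.-1 ->
  fold_coord u k <= fold_coord u k.+1.
Proof.
case: k => [_|[|k] km]; rewrite /fold_coord /=.
- by move=> *; rewrite le_max; case: (leP (- 2^-1) (u 0%N)) => //= ?; lra.
(* For $m=2$ the two folded coordinates are adjacent, and comparing the maximum with the minimum
   takes four inequalities, including $x_{2m}-1\le x_{m+1}$. *)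
- have [e1|_] := eqVneq 1%N m.-1; last by move=> H1 H2 *; rewrite m2 ge_max H1 H2.
  have e2 : m.-2 = 0%N by lia.
  by rewrite e2 -e1 => H1 H2 _ _ H5 H6; rewrite ge_max !le_min H1 H2 H5 H6.
have [kE|kn] := eqVneq k.+1 m.-1.
  have -> : (k.+2 == m.-1) = false by lia.
  have -> : (k.+2 < m)%N = false by lia.
  by move=> *; rewrite ge_min; case: (leP (u m.-1) 0) => //= ?; lra.
have -> : (k.+1 < m)%N by lia.
have -> : (k.+2 < m)%N by lia.
have [kE|kn'] := eqVneq k.+2 m.-1.
  have -> : k.+1 = m.-2 by lia.
  by move=> _ _ _ H4 H5 _; rewrite le_min H4 H5.
have km' : (k.+2 < m.-1)%N by lia.
by move=> _ _ H3 _ _ _; exact: H3.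
Qed.

End Fold.

Section Vertices.
Variables (R : realType) (m : nat).
Hypothesis m2 : (2 <= m)%N.
Variables c d : 'I_(m.*2).
Hypotheses (cE : c = m.*2.-1 :> nat) (dE : d = m.-1 :> nat).

(** In coordinates this is $(-1,0^{(2m-2)},1)$, and [am'] is
    $((-\frac12)^{(m-1)},\frac12,-\frac12,(\frac12)^{(m-1)})$. *)
Let a0' := face_point R m 0 + pair_vec R c.
Let am' := face_point R m m + pair_vec R d.

Lemma vertex0_closed : alcove_ineqs <=%R a0'.
Proof.
pose F j : R := if (j == 0)%N then -1 else if (j == m.*2.-1)%N then 1 else 0.
have aE : a0' = \row_(j < m.*2) F j.
  apply/rowP => j; rewrite !row_linE pair_vecE !mxE ltn0 subn0 ltn_ord /F.
  rewrite -!(inj_eq val_inj) /= cE; have jm := ltn_ord j.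
  have -> : (m.*2 - m.*2.-1.+1 = 0)%N by lia.
  have [j0|j0] := eqVneq (j : nat) 0%N.
    have -> : (j == m.*2.-1 :> nat) = false by lia.
    by rewrite /=; lra.
  by case: (_ == _) => /=; lra.
have E i : (i.-1 < m.*2)%N -> entry a0' i = F i.-1 by rewrite aE; exact: entry_row.
have mid i : (0 < i.-1)%N -> (i.-1 < m.*2.-1)%N -> entry a0' i = 0.
  by move=> i0 im; rewrite E ?/F; [rewrite !ifF //; lia|lia].
have low i : (i.-1 < m.*2.-1)%N -> entry a0' i <= 0.
  move=> im; rewrite E ?/F; last lia.
  case: ifP => _; first by lra.
  by rewrite ifF //; lia.
have top : entry a0' m.*2 = 1.
  by rewrite E ?/F; [rewrite ifF ?eqxx //; lia|lia].
split; rewrite ?top ?subrr.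
- by rewrite (mid 2) ?low //; lia.
- by rewrite (mid 2) //; lia.
- by move=> j j1 j2; rewrite (mid j.+1) ?low //; lia.
- by rewrite (mid m) ?low //; lia.
- by rewrite (mid m.+1) ?low //; lia.
Qed.

Lemma vertex_top_closed : alcove_ineqs <=%R am'.
Proof.
pose F j : R := if (j < m.-1)%N || (j == m) then - 2^-1 else 2^-1.
have aE : am' = \row_(j < m.*2) F j.
  apply/rowP => j; rewrite !row_linE pair_vecE !mxE /F.
  rewrite -!(inj_eq val_inj) /= dE; have jm := ltn_ord j.
  have -> : (m.*2 - m.-1.+1 = m)%N by lia.
  have -> : (m.*2 - m = m)%N by lia.
  have [j0|j0] := ltnP j m.-1.
    have -> : (j < m)%N by lia.
    have -> : (j == m.-1 :> nat) = false by lia.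
    have -> : (j == m :> nat) = false by lia.
    by rewrite /=; lra.
  have [j1|j1] := ltnP j m.
    have -> : (j == m.-1 :> nat) by lia.
    have -> : (j == m :> nat) = false by lia.
    by rewrite /=; lra.
  have -> : (j == m.-1 :> nat) = false by lia.
  by case: (_ == _) => /=; lra.
have E i : (i.-1 < m.*2)%N -> entry am' i = F i.-1 by rewrite aE; exact: entry_row.
have F_ge j : - 2^-1 <= F j by rewrite /F; case: ifP => _; lra.
have low i j : (i.-1 < m.-1)%N -> (j.-1 < m.*2)%N -> entry am' i <= entry am' j.
  move=> im jm; rewrite !E //; last by lia.
  by rewrite {1}/F im.
have top j : (j.-1 < m.*2)%N -> entry am' m.*2 - 1 <= entry am' j.
  move=> jm; rewrite !E //; last by lia.
  apply: le_trans (F_ge _); rewrite /F ifF; last by lia.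
  by lra.
split; try by [apply: low; lia|apply: top; lia].
  by move=> j j1 j2; apply: low; lia.
by split; [apply: low; lia|apply: top; lia].
Qed.

(* Folding v by the reflections through the walls x_1 = -1/2 and x_m = 0 puts it
   in the simplex with vertices a_0, ..., a_m; only a_0 and a_m are moved when
   the result is unfolded. *)
Lemma alcove_decomposition v : apartment R m v -> alcove_ineqs <=%R v ->
  exists (s : R) (a : 'I_m.+1 -> R) (x : 'I_m.+1 -> 'rV[R]_(m.*2)),
  [/\ forall k, 0 <= a k, \sum_k a k = 1, v = const_mx s + \sum_k a k *: x k &
      forall k, x k = face_point R m k \/ x k = a0' \/ x k = am'].
Proof.
move=> /apartmentP vA [h1 h2 h3 h4 [h5 h6]].
have zlt : (0 < m.*2)%N by lia.
pose z := Ordinal zlt.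
(* Half of the common pair sum; subtracting it makes the point antisymmetric. *)
pose s := (v 0 z + v 0 (rev_ord z)) / 2.
have vrev j : v 0 (rev_ord j) = 2 * s - v 0 j.
  by have := vA j z; rewrite /s; lra.
pose u i := entry v i.+1 - s.
have uE (j : 'I_(m.*2)) : v 0 j = u j + s by rewrite /u (@entry_ord _ _ _ j) //; ring.
have u_rev i : (i < m.*2)%N -> u (m.*2 - i.+1)%N = - u i.
  move=> im; have := vrev (Ordinal im); rewrite !uE /=; lra.
have e_top : entry v m.*2 = s - u 0%N.
  have := u_rev 0%N zlt; rewrite subn1 {1}/u prednK // => h.
  by rewrite -[LHS](addrNK s) h; ring.
have e_mid : entry v m.+1 = s - u m.-1.
  have := @u_rev m.-1; rewrite {1}/u (_ : m.*2 - m.-1.+1 = m)%N; last by lia.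
  by move=> h; rewrite -[LHS](addrNK s) h; [ring|lia].
have e i : (0 < i)%N -> entry v i = u i.-1 + s.
  by move=> i0; rewrite /u prednK //; ring.
pose F := fold_coord m u.
have F_top : F m.+1 = 0 by rewrite /F /= !ifF //; lia.
have H1 : u 0%N <= u 1%N by move: h1; rewrite !e //=; lra.
have H2 : - 1 - u 0%N <= u 1%N by move: h2; rewrite e_top e //=; lra.
have H3 i : (0 < i)%N -> (i.+1 < m.-1)%N -> u i <= u i.+1.
  by move=> i0 im; have := h3 i.+1 i0 im; rewrite !e //=; lra.
have m1 : (0 < m.-1)%N by lia.
have m0 : (0 < m)%N by lia.
have H4 : u m.-2 <= u m.-1 by move: h4; rewrite !e //; lra.
have H5 : u m.-2 <= - u m.-1 by move: h5; rewrite e_mid e //; lra.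
have H6 : - 1 - u 0%N <= - u m.-1 by move: h6; rewrite e_mid e_top; lra.
have F_mono k : (k <= m)%N -> F k <= F k.+1.
  by move=> km; apply: fold_coord_mono.
clear H1 H2 H3 H4 H5 H6 h1 h2 h3 h4 h5 h6 e_top e_mid.
(* Barycentric coordinates of the folded point; the factor 2 is there because consecutive points
   $a_k$ differ by $\frac12$ in one coordinate of the first half. *)
pose a (k : 'I_m.+1) := 2 * (F k.+1 - F k).
(* These record whether each of the two reflections was used; if so, the corresponding vertex is
   replaced by its mirror image. *)
pose eps := u 0%N < - 2^-1; pose del := 0 < u m.-1.
pose x (k : 'I_m.+1) := face_point R m k
  + ((k == ord0) && eps)%:R *: pair_vec R c
  + ((k == ord_max) && del)%:R *: pair_vec R d.
exists s, a, x; split.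
- by move=> k; rewrite mulr_ge0 // subr_ge0 F_mono // -ltnS.
- rewrite -mulr_sumr -(big_mkord predT (fun k => F k.+1 - F k)) telescope_sumr // F_top.
  by rewrite /F /=; lra.
- have xrev k j : x k 0 (rev_ord j) = - x k 0 j.
    have := pair_vec_rev_sum R c j; have := pair_vec_rev_sum R d j.
    have := @face_point_rev R m m2 k j (ltn_ord k).
    rewrite /x !row_linE => f0 d0 c0.
    by rewrite -(addr0_eq f0) -(addr0_eq d0) -(addr0_eq c0); ring.
  have sumE j : (const_mx s + \sum_k a k *: x k) 0 j = s + \sum_k a k * x k 0 j.
    by rewrite row_addE mxE summxE; congr (_ + _); apply: eq_bigr => k _; rewrite mxE.
  suff low (j : 'I_(m.*2)) : (j < m)%N -> u j = \sum_k a k * x k 0 j.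
    apply/rowP => j; rewrite sumE uE addrC; congr (_ + _).
    have [jm|jm] := ltnP j m; first exact: low.
    have jm' : (rev_ord j < m)%N by rewrite ltn_rev_ord -leqNgt.
    have := u_rev j (ltn_ord j); have := low _ jm' => /= -> h.
    rewrite -[u j]opprK -h -sumrN; apply: eq_bigr => k _.
    by rewrite xrev mulrN opprK.
  move=> jm.
  have -> : \sum_k a k * x k 0 j = \sum_(k < m.+1) a k * face_point R m k 0 j
      + a ord0 * eps%:R * pair_vec R c 0 j + a ord_max * del%:R * pair_vec R d 0 j.
    have -> : a ord0 * eps%:R * pair_vec R c 0 j =
        \sum_k a k * ((k == ord0) && eps)%:R * pair_vec R c 0 j.
      rewrite (bigD1 ord0) //= big1 ?addr0 // => k /negPf ->.
      by rewrite mulr0 mul0r.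
    have -> : a ord_max * del%:R * pair_vec R d 0 j =
        \sum_k a k * ((k == ord_max) && del)%:R * pair_vec R d 0 j.
      rewrite (bigD1 ord_max) //= eqxx big1 ?addr0 // => k /negPf ->.
      by rewrite mulr0 mul0r.
    by rewrite -!big_split; apply: eq_bigr => k _; rewrite /x !row_linE /=; ring.
  (* In the first half, $a_k$ is $-\frac12$ at [j] exactly when [j < k] and 0 otherwise, so the sum
     telescopes. *)
  have -> : \sum_(k < m.+1) a k * face_point R m k 0 j = F j.+1.
    rewrite (eq_bigr (fun k : 'I_m.+1 => if (j < k)%N then F k - F k.+1 else 0)); last first.
      move=> k _; rewrite mxE; case: ifP => jk; first by rewrite /a; field.
      by rewrite ifT ?mulr0 //; have := ltn_ord k; lia.
    by rewrite sum_tail // ltnW.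
  have pcE : pair_vec R c 0 j = - (j == 0 :> nat)%:R.
    rewrite pair_vecE -!(inj_eq val_inj) /= cE.
    have -> : (j == m.*2.-1 :> nat) = false by lia.
    have -> : (m.*2 - m.*2.-1.+1 = 0)%N by lia.
    by rewrite sub0r.
  have pdE : pair_vec R d 0 j = (j == m.-1 :> nat)%:R.
    rewrite pair_vecE -!(inj_eq val_inj) /= dE.
    have -> : (j == m.*2 - m.-1.+1 :> nat)%N = false by lia.
    by rewrite subr0.
  have a0 : a ord0 = 2 * Num.max (u 0%N) (- 1 - u 0%N) + 1 by rewrite /a /F /=; lra.
  have Fm k : k = m -> F k = Num.min (u m.-1) (- u m.-1).
    case: k => [|k] kE; first by lia.
    have -> : k = m.-1 by lia.
    by rewrite /F /= eqxx ifF //; lia.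
  have am : a ord_max = - 2 * Num.min (u m.-1) (- u m.-1).
    by rewrite /a -[nat_of_ord ord_max]/m F_top Fm //; ring.
  rewrite pcE pdE a0 am /F /=.
  (* The correction terms undo the folding: $F_1$ minus the coefficient of $a_0$, and $F_m$ plus the
     coefficient of $a_m$, are the original coordinates. *)
  have [j0|j0] := eqVneq (j : nat) 0%N.
    have -> : (j == m.-1 :> nat) = false by lia.
    by rewrite j0 /eps maxEle; case: ltP => ?; case: leP => ?; rewrite /=; lra.
  have [j1|j1] := eqVneq (j : nat) m.-1; last by rewrite jm /=; ring.
  by rewrite j1 /del minEle; case: ltP => ?; case: leP => ?; rewrite /=; lra.
- move=> k; rewrite /x.
  have [->|k0] := eqVneq k ord0; have [e0|e0] := eqVneq _ ord_max.
  + by move/(congr1 val): e0 => /=; lia.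
  + rewrite /= scale0r addr0.
    by case: (eps); rewrite ?scale1r ?scale0r ?addr0; [right; left|left].
  + rewrite e0 /= scale0r addr0.
    by case: (del); rewrite ?scale1r ?scale0r ?addr0; [right; right|left].
  + by rewrite /= !scale0r !addr0; left.
Qed.


End Vertices.

(** * Finite convex combinations and limits in the region *)

Section HullClosure.
Variables (R : realType) (m q : nat).
Implicit Types x y : 'rV[R]_(m.*2).

Lemma hullD_sum n (a : 'I_n -> R) (x : 'I_n -> 'rV[R]_(m.*2)) :
  (forall k, 0 <= a k) -> \sum_k a k = 1 -> (forall k, hullD q (x k)) ->
  hullD q (\sum_k a k *: x k).
Proof.
move=> a0 a1 hx.
have sE j : (\sum_k a k *: x k) 0 j = \sum_k a k * x k 0 j.
  by rewrite summxE; apply: eq_bigr => k _; rewrite row_scaleE.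
have dE j : `|(\sum_k a k *: x k) 0 j - 1| <= \sum_k a k * `|x k 0 j - 1|.
  rewrite sE -[X in `|_ - X| <= _]a1 -sumrB; apply: le_trans (ler_norm_sum _ _ _) _.
  apply: ler_sum => k _.
  have -> : a k * x k 0 j - a k = a k * (x k 0 j - 1) by ring.
  by rewrite normrM (ger0_norm (a0 k)).
split.
- move=> j; rewrite !sE -big_split /= -[RHS]mulr1 -[X in _ = _ * X]a1 mulr_sumr.
  by apply: eq_bigr => k _; have [/(_ j) h _ _] := hx k; rewrite -mulrDr h mulrC.
- move=> j; apply: le_trans (dE j) _; rewrite -[leRHS]a1; apply: ler_sum => k _.
  by have [_ /(_ j) h _] := hx k; rewrite -[leRHS]mulr1 ler_wpM2l.
- apply: le_trans (ler_sum _ (fun j _ => dE j)) _; rewrite exchange_big /=.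
  rewrite -[leRHS]mulr1 -[X in _ <= _ * X]a1 mulr_sumr; apply: ler_sum => k _.
  by have [_ _ h] := hx k; rewrite -mulr_sumr mulrC ler_wpM2r.
Qed.

Lemma le_limit (a b e : R) : (forall t, 0 < t <= 1 -> a <= b + t * e) -> a <= b.
Proof.
move=> h; rewrite leNgt; apply/negP => ba.
have e0 : 0 < e by have := h 1; rewrite ltr01 lexx => /(_ isT); lra.
(* For this [t] the error [t * e] is at most half of the gap [a - b]. *)
have t0 : 0 < Num.min 1 ((a - b) / (2 * e)).
  by rewrite lt_min ltr01 divr_gt0; lra.
have := h (Num.min 1 ((a - b) / (2 * e))); rewrite t0 ge_min lexx => /(_ isT).
have : Num.min 1 ((a - b) / (2 * e)) * e <= (a - b) / (2 * e) * e.
  by rewrite ler_pM2r // ge_min lexx orbT.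
have -> : (a - b) / (2 * e) * e = (a - b) / 2 by field; lra.
by lra.
Qed.

(** Closedness along a segment: each inequality at [x] holds up to an error that is linear in
    [t]. *)
Lemma hullD_limit x y :
  (forall t, 0 < t <= 1 -> hullD q ((1 - t) *: x + t *: y)) -> hullD q x.
Proof.
move=> h; have E t j : ((1 - t) *: x + t *: y) 0 j = x 0 j + t * (y 0 j - x 0 j).
  by rewrite !row_linE; ring.
have N t j : 0 < t <= 1 ->
    `|x 0 j - 1| <= `|((1 - t) *: x + t *: y) 0 j - 1| + t * `|y 0 j - x 0 j|.
  move=> /andP[t0 _]; rewrite E.
  have {1}-> : x 0 j - 1 = (x 0 j + t * (y 0 j - x 0 j) - 1) - t * (y 0 j - x 0 j) by ring.
  by apply: le_trans (ler_normB _ _) _; rewrite normrM (gtr0_norm t0).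
split.
(* An equation affine in [t] that holds at $t=1$ and $t=\frac12$ also holds at $t=0$. *)
- have t1 : 0 < (1 : R) <= 1 by rewrite ltr01 lexx.
  have t2 : 0 < (2^-1 : R) <= 1 by lra.
  move=> j; have [/(_ j) h1 _ _] := h _ t1; have [/(_ j) h2 _ _] := h _ t2.
  by move: h1 h2; rewrite !E; lra.
- move=> j; apply: (@le_limit _ _ `|y 0 j - x 0 j|) => t t01.
  apply: le_trans (N t j t01) _; rewrite lerD2r.
  by have [_ + _] := h t t01; apply.
- apply: (@le_limit _ _ (\sum_j `|y 0 j - x 0 j|)) => t t01.
  apply: le_trans (ler_sum _ (fun j _ => N t j t01)) _.
  by rewrite big_split /= mulr_sumr lerD2r; have [_ _] := h t t01.
Qed.

End HullClosure.

(** * Testing permissibility at finitely many points *)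

Section Permissible.
Variables (R : realType) (m q : nat) (w : affperm m.*2).
Hypotheses (m2 : (2 <= m)%N) (qm : (q < m)%N) (wX : extWeylD m w).
Variables c d : 'I_(m.*2).
Hypotheses (cE : c = m.*2.-1 :> nat) (dE : d = m.-1 :> nat).

(** The displacement is affine in the point. The listed points lie in the closed alcove, hence are
    limits of alcove points; conversely every alcove point is, up to a constant vector, a convex
    combination of them. *)
Lemma permissible_verticesP :
  (forall v, base_alcoveD R m v -> conv_weyl_orbit R m (muq m q) (affact w v - v)) <->
  [/\ forall k, (k <= m)%N -> hullD q (nuvec R w k),
      hullD q (disp w (face_point R m 0 + pair_vec R c)) &
      hullD q (disp w (face_point R m m + pair_vec R d))].
Proof.
split=> [h|[hk h0 hm] v].
  have lim v : apartment R m v -> alcove_ineqs <=%R v -> hullD q (disp w v).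
    move=> vA vI; have [uA uI] := alcove_pt_in R m2.
    apply: (@hullD_limit _ _ _ _ (disp w (alcove_pt R m))) => t t01.
    rewrite -disp_mix -affact_disp -conv_weyl_orbitE //; apply: h.
    apply/base_alcoveDP => //; split; first exact: apartment_mix.
    exact: alcove_ineqs_mix.
  have fA k b t : (k <= m)%N -> apartment R m (face_point R m k + t *: pair_vec R b).
    move=> km; apply: (@apartment_dual _ _ 0) => j; rewrite !row_linE addrACA.
    by rewrite face_point_rev // -mulrDr pair_vec_rev_sum; ring.
  split=> [k km||].
  - rewrite /nuvec affact_disp; apply: lim; last exact: face_point_closed.
    by rewrite -[face_point _ _ _]addr0 -(scale0r (pair_vec R c)); exact: fA.
  - by apply: lim; [rewrite -[pair_vec _ _]scale1r; exact: fA|exact: (vertex0_closed R m2 cE dE)].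
  - by apply: lim; [rewrite -[pair_vec _ _]scale1r; exact: fA|exact: (vertex_top_closed R m2 cE dE)].
move=> /(base_alcoveDP m2)[vA [v1 v2 v3 v4 [v5 v6]]]; apply/conv_weyl_orbitE => //.
have vI : alcove_ineqs <=%R v.
  by split; rewrite ?ltW // => j j1 j2; rewrite ltW // v3.
have [s [a [x [a0 a1 -> hx]]]] := alcove_decomposition m2 cE dE vA vI.
rewrite affact_disp disp_const disp_sum //; apply: hullD_sum => // k.
case: (hx k) => [->|[->|->]] //.
by rewrite -affact_disp; apply: hk; rewrite -ltnS.
Qed.

End Permissible.

Theorem proposition8p6p4 (R : realType) (m q : nat) (w : affperm m.*2) :
  (2 <= m)%N -> (q <= m.-1)%N -> extWeylD m w ->
  permissibleD R (muq m q) w <->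
  (forall k, (k <= m)%N -> SP1 (nuvec R w k) /\ SP2 q (nuvec R w k)) /\
  (forall k, k \in [:: 0; 1; m.-1; m]%N -> SP3 q k (nuvec R w k)).
Proof.
move=> m2 qm1 wX; have qm : (q < m)%N by lia.
have cm : (m.*2.-1 < m.*2)%N by lia.
have dm : (m.-1 < m.*2)%N by lia.
have cE : Ordinal cm = m.*2.-1 :> nat by [].
have dE : Ordinal dm = m.-1 :> nat by [].
have mm1 : (m.-1 <= m)%N by lia.
have m1 : (1 <= m)%N by lia.
rewrite /permissibleD (eqmod_affWeylDP qm wX) (permissible_verticesP R w m2 qm cE dE).
split=> [[lQ [hk h0 hm]]|[h12 h3]].
  split=> [k km|k]; first by apply/SP12_hullD/hk.
  rewrite !inE => /or4P[]/eqP ->.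
  - exact/SP3_0.
  - exact/(SP3_1 qm wX cE lQ (hk _ (leq0n m)) (hk _ m1)).
  - exact/(SP3_pred qm wX dE lQ (hk _ (leqnn m)) (hk _ mm1)).
  - exact: SP3_top.
have hk k : (k <= m)%N -> hullD q (nuvec R w k) by move=> km; apply/SP12_hullD/h12.
(* The congruence is recovered first, from $k=0$, because the equivalences for $k=1$ and $k=m-1$
   presuppose it. *)
have lQ : corootD m (w.1 - muq m q) by apply/(SP3_0 R)/h3; rewrite !inE eqxx.
split=> //; split=> //.
- by apply/(SP3_1 qm wX cE lQ (hk _ (leq0n m)) (hk _ m1)); apply: h3; rewrite !inE eqxx !orbT.
- by apply/(SP3_pred qm wX dE lQ (hk _ (leqnn m)) (hk _ mm1)); apply: h3; rewrite !inE eqxx !orbT.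
Qed.
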